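(* Let $\Omega\subset\mathbb{C}^n$ be a bounded domain, let $z\in\Omega$, and let $X=\sum_{j=1}^n X_j\,\partial/\partial z_j$ be a nonzero holomorphic tangent vector. Let $$S_{z,X}:=\{f\in A^2(\Omega): f(z)=0,\ Xf(z)=0\},$$ and let $P_{z,X}$ be the orthogonal projection from $A^2(\Omega)$ onto $S_{z,X}^\perp$, the orthogonal complement of $S_{z,X}$ in $A^2(\Omega)$. Let $b_z:=K_\Omega(\cdot,z)/\sqrt{K_\Omega(z)}$, let $c_{z,X}\in\mathcal{O}(\Omega)$ be any function satisfying $c_{z,X}(z)=0$, $|c_{z,X}|<1$ on $\Omega$ and $Xc_{z,X}(z)=C_\Omega(z;X)$, and let $b_{z,X}$ be the unique function that attains the maximum $$\max\{|Xf(z)|: f\in\mathcal{O}(\Omega),\ f(z)=0,\ \|f\|_{L^2(\Omega)}\le 1\}$$ and satisfies $Xb_{z,X}(z)>0$. Then $$\frac{C_\Omega(z;X)}{B_\Omega(z;X)}\,b_{z,X}=P_{z,X}(b_z c_{z,X}).$$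
   Context: $\mathcal{O}(\Omega)$ denotes the holomorphic functions on $\Omega$. $L^2(\Omega)$ is taken with respect to Lebesgue measure, and $A^2(\Omega)=L^2(\Omega)\cap\mathcal{O}(\Omega)$ is the Bergman space with the $L^2$ inner product. $K_\Omega(\zeta,z)=\sum_{j\ge 0}h_j(\zeta)\overline{h_j(z)}$ is the Bergman kernel, where $\{h_j\}$ is any complete orthonormal basis of $A^2(\Omega)$, and $K_\Omega(z):=K_\Omega(z,z)$. For $X=\sum_j X_j\,\partial/\partial z_j$ with $X_j\in\mathbb{C}$ and $f$ holomorphic, $Xf(z)=\sum_j X_j\frac{\partial f}{\partial z_j}(z)$. The Bergman metric and Carathéodory metric are $$B_\Omega(z;X)=\frac{1}{\sqrt{K_\Omega(z)}}\max\{|Xf(z)|: f\in\mathcal{O}(\Omega),\ f(z)=0,\ \|f\|_{L^2(\Omega)}\le 1\},$$ $$C_\Omega(z;X)=\max\{|Xf(z)|: f\in\mathcal{O}(\Omega),\ f(z)=0,\ |f|<1\}.$$ A function $c_{z,X}$ as in the claim exists but need not be unique. *)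

(* Defs.v *)
From HB Require Import structures.
From mathcomp Require Import all_boot all_order all_algebra.
From mathcomp Require Import all_classical all_reals all_analysis.
From mathcomp Require Import complex.

Set Implicit Arguments.
Unset Strict Implicit.
Unset Printing Implicit Defensive.

Import Order.TTheory GRing.Theory Num.Theory.
Import numFieldNormedType.Exports.

Local Open Scope classical_set_scope.
Local Open Scope ring_scope.

(* Typing [R[i]] as a numClosedFieldType gives it, and the row vectors over it,
   the normed-module structure over itself.  Hence [differentiable] and ['D_v]
   below are complex (Frechet, directional) differentiability.  The order of
   [Cplx R] is the partial one for which [x <= y] iff [y - x] is a nonnegative
   real, so that nonnegative reals such as [`|x|] live in [Cplx R]. *)
Definition Cplx (R : realType) : numClosedFieldType := R[i].

Notation Cvec R n := 'rV[Cplx R]_n.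

Section cons_measure.
Context {d : measure_display} {T : measurableType d} {R : realType}.
Variables (n : nat) (m : {sigma_finite_measure set T -> \bar R}).
Variable (mn : {sigma_finite_measure set (n.-tuple T) -> \bar R}).

Definition tuple_cons (p : T * n.-tuple T) : n.+1.-tuple T :=
  [tuple of p.1 :: p.2].

Let preimage_tuple_cons (A : set (n.+1.-tuple T)) :
  measurable A -> measurable (tuple_cons @^-1` A).
Proof.
move=> mA; rewrite -[X in measurable X]setTI.
exact: (measurable_cons measurable_fst measurable_snd).
Qed.

Definition cons_measure : set (n.+1.-tuple T) -> \bar R :=
  pushforward (m \x mn)%E tuple_cons.

Let cons_measure0 : cons_measure set0 = 0%E.
Proof. by rewrite /cons_measure /pushforward preimage_set0 measure0. Qed.

Let cons_measure_ge0 A : (0 <= cons_measure A)%E.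
Proof. exact: (measure_ge0 (m \x mn)%E). Qed.

Let cons_measure_sigma_additive : semi_sigma_additive cons_measure.
Proof.
move=> F mF tF mUF; rewrite /cons_measure /pushforward preimage_bigcup.
apply: (@measure_semi_sigma_additive _ _ _ (m \x mn)%E
  (fun k => tuple_cons @^-1` F k)).
- by move=> k; exact: preimage_tuple_cons.
- apply/trivIsetP => i j _ _ ij; rewrite -preimage_setI.
  by move/trivIsetP : tF => /(_ _ _ _ _ ij) -> //; rewrite preimage_set0.
- by rewrite -preimage_bigcup; exact: preimage_tuple_cons.
Qed.

HB.instance Definition _ := isMeasure.Build _ _ _ cons_measure
  cons_measure0 cons_measure_ge0 cons_measure_sigma_additive.

Let cons_measure_sigma_finite : sigma_finite setT cons_measure.
Proof.
have /sigma_finiteP[F [TF ndF Foo]] := sigma_finiteT m.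
have /sigma_finiteP[G [TG ndG Goo]] := sigma_finiteT mn.
exists (fun k => (@thead n T) @^-1` F k `&`
                 (fun t : n.+1.-tuple T => [tuple of behead t]) @^-1` G k).
  apply/esym; rewrite -subTset => t _.
  have [i _ Fi] : (\bigcup_i F i) (thead t) by rewrite -TF.
  have [j _ Gj] : (\bigcup_i G i) [tuple of behead t] by rewrite -TG.
  exists (maxn i j) => //; split.
  - by have /subsetPset := ndF _ _ (leq_maxl i j); exact.
  - by have /subsetPset := ndG _ _ (leq_maxr i j); exact.
move=> k; have [mF Fk] := Foo k; have [mG Gk] := Goo k; split.
  apply: measurableI.
  - by rewrite -[X in measurable X]setTI; exact: measurable_tnth.
  - by rewrite -[X in measurable X]setTI; exact: measurable_behead.
rewrite /cons_measure /pushforward (_ : _ @^-1` _ = F k `*` G k).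
  by rewrite product_measure1E// lte_mul_pinfty// ge0_fin_numE.
have consK (x : T) (t : n.-tuple T) :
    [tuple of behead (tuple_cons (x, t))] = t.
  exact: val_inj.
by apply/seteqP; split => -[x t] /=; rewrite consK.
Qed.

HB.instance Definition _ :=
  Measure_isSigmaFinite.Build _ _ _ cons_measure cons_measure_sigma_finite.

End cons_measure.

Section tuple_measure.
Context {d : measure_display} {T : measurableType d} {R : realType}.

(* The product of [n] copies of [m]. *)
Fixpoint tuple_measure (m : {sigma_finite_measure set T -> \bar R}) n :
    {sigma_finite_measure set (n.-tuple T) -> \bar R} :=
  if n is k.+1 then cons_measure m (tuple_measure m k) else \d_([tuple]).

End tuple_measure.

(* C^n is identified with R^2n through [cvec (x, y) = x + i y]; it carries the
   Borel sigma-algebra and the Lebesgue measure transported from R^2n. *)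
Section lebesgue_Cn.
Variables (R : realType) (n : nat).

Definition cvec (u : (n + n).-tuple R) : Cvec R n :=
  \row_j (Complex (tnth u (lshift n j)) (tnth u (rshift n j)) : Cplx R).

Definition Cvec_measurable : set (set (Cvec R n)) :=
  [set A | @measurable _ ((n + n).-tuple (measurableTypeR R)) (cvec @^-1` A)].

Let Cvec_measurable0 : Cvec_measurable set0.
Proof. by rewrite /Cvec_measurable /= preimage_set0. Qed.

Let Cvec_measurableC A : Cvec_measurable A -> Cvec_measurable (~` A).
Proof. by rewrite /Cvec_measurable /= -preimage_setC; exact: measurableC. Qed.

Let Cvec_measurable_bigcup (F : (set (Cvec R n))^nat) :
  (forall i, Cvec_measurable (F i)) -> Cvec_measurable (\bigcup_i F i).
Proof.
move=> mF; rewrite /Cvec_measurable /= preimage_bigcup.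
exact: bigcupT_measurable.
Qed.

HB.instance Definition _ := @isMeasurable.Build default_measure_display
  (Cvec R n) Cvec_measurable
  Cvec_measurable0 Cvec_measurableC Cvec_measurable_bigcup.

Lemma measurable_cvec :
  measurable_fun [set: (n + n).-tuple (measurableTypeR R)] cvec.
Proof. by move=> _ A mA; rewrite setTI. Qed.

Definition lebesgue_Cn : set (Cvec R n) -> \bar R :=
  pushforward (tuple_measure (@lebesgue_measure R) (n + n)) cvec.

Let lebesgue_Cn0 : lebesgue_Cn set0 = 0%E.
Proof. by rewrite /lebesgue_Cn /pushforward preimage_set0 measure0. Qed.

Let lebesgue_Cn_ge0 A : (0 <= lebesgue_Cn A)%E.
Proof. exact: (measure_ge0 (tuple_measure (@lebesgue_measure R) (n + n))). Qed.

Let lebesgue_Cn_sigma_additive : semi_sigma_additive lebesgue_Cn.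
Proof.
move=> F mF tF mUF; rewrite /lebesgue_Cn /pushforward preimage_bigcup.
apply: (@measure_semi_sigma_additive _ _ _
  (tuple_measure (@lebesgue_measure R) (n + n)) (fun k => cvec @^-1` F k)).
- by move=> k; exact: mF.
- apply/trivIsetP => i j _ _ ij; rewrite -preimage_setI.
  by move/trivIsetP : tF => /(_ _ _ _ _ ij) -> //; rewrite preimage_set0.
- by rewrite -preimage_bigcup; exact: mUF.
Qed.

HB.instance Definition _ := isMeasure.Build _ _ _ lebesgue_Cn
  lebesgue_Cn0 lebesgue_Cn_ge0 lebesgue_Cn_sigma_additive.

End lebesgue_Cn.
Arguments lebesgue_Cn {R n}.

Section bergman.
Variables (R : realType) (n : nat).
Local Notation C := (Cplx R).
Local Notation V := (Cvec R n).
Implicit Types (Omega : set V) (f g : V -> C) (z zeta X : V).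

(* Functions on [Omega] are represented by total functions on C^n, whose values
   outside [Omega] are irrelevant. *)
Definition holomorphic Omega f := forall z, Omega z -> differentiable f z.

(* X f (z) for X = \sum_j X_j d/dz_j *)
Definition tangent X f z : C := \sum_(j < n) X 0 j * 'D_(delta_mx 0 j) f z.

Definition L2norm Omega f : \bar R :=
  'N[lebesgue_Cn]_2%:E[(fun zeta => (complex.Re `|f zeta|)%:E) \_ Omega]%E.

Definition L2 Omega : set (V -> C) :=
  [set f | [/\ measurable_fun Omega (fun zeta => complex.Re (f zeta) : R),
               measurable_fun Omega (fun zeta => complex.Im (f zeta) : R) &
               (L2norm Omega f < +oo)%E]].

Definition cintegral Omega f : C :=
  Complex (\int[lebesgue_Cn]_(zeta in Omega) complex.Re (f zeta))
          (\int[lebesgue_Cn]_(zeta in Omega) complex.Im (f zeta)).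

Definition inner Omega f g : C :=
  cintegral Omega (fun zeta => f zeta * (g zeta)^*).

Definition bergman_space Omega : set (V -> C) :=
  L2 Omega `&` [set f | holomorphic Omega f].

Definition complete_orthonormal_basis Omega (h : nat -> V -> C) :=
  [/\ forall j, bergman_space Omega (h j),
      forall i j, inner Omega (h i) (h j) = (i == j)%:R &
      forall f, bergman_space Omega f ->
        L2norm Omega (fun zeta =>
          f zeta - \sum_(0 <= j < N) inner Omega f (h j) * h j zeta)
        @[N --> \oo] --> 0%E].

(* The kernel K_Omega(zeta, z) computed in the orthonormal basis [h]. *)
Definition bergman_kernel (h : nat -> V -> C) zeta z : C :=
  limn (series (fun j => h j zeta * (h j z)^*)).

(* Meaningful for sets of real elements that have a maximum; 0 otherwise. *)
Definition maximum (A : set C) : C :=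
  xget 0 [set m | A m /\ forall x, A x -> x <= m].

Definition bergman_competitors Omega z : set (V -> C) :=
  [set f | [/\ holomorphic Omega f, f z = 0 & (L2norm Omega f <= 1)%E]].

Definition bergman_max Omega z X : C :=
  maximum [set `|tangent X f z| | f in bergman_competitors Omega z].

Definition bergman_metric Omega (h : nat -> V -> C) z X : C :=
  (sqrtC (bergman_kernel h z z))^-1 * bergman_max Omega z X.

Definition caratheodory_competitors Omega z : set (V -> C) :=
  [set f | [/\ holomorphic Omega f, f z = 0 &
               forall zeta, Omega zeta -> `|f zeta| < 1]].

Definition caratheodory_metric Omega z X : C :=
  maximum [set `|tangent X f z| | f in caratheodory_competitors Omega z].

Definition orthogonal_complement Omega (S : set (V -> C)) : set (V -> C) :=
  [set g | bergman_space Omega g /\ forall s, S s -> inner Omega g s = 0].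

(* The orthogonal projection of [f] onto [W], which as an element of the Bergman
   space is determined on [Omega] only. *)
Definition orthogonal_projection Omega (W : set (V -> C)) f : V -> C :=
  xget (fun=> 0)
    [set g | W g /\ forall w, W w -> inner Omega (f \- g) w = 0].

Definition vanishing_space Omega z X : set (V -> C) :=
  [set f | [/\ bergman_space Omega f, f z = 0 & tangent X f z = 0]].

Definition normalized_kernel (h : nat -> V -> C) z : V -> C :=
  fun zeta => bergman_kernel h zeta z / sqrtC (bergman_kernel h z z).

End bergman.

(* Main.v *)
Require Import Defs.
From HB Require Import structures.
From mathcomp Require Import all_boot all_order all_algebra.
From mathcomp Require Import all_classical all_reals all_analysis.
From mathcomp Require Import measurable_realfun complex ring lra.
Set Implicit Arguments.
Unset Strict Implicit.
Unset Printing Implicit Defensive.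
Import Order.TTheory GRing.Theory Num.Theory.
Import numFieldNormedType.Exports.
Local Open Scope classical_set_scope.
Local Open Scope ring_scope.

(** Write F for the product b_z c and la for the quotient of the two metrics.  At z
both F and la b vanish, and X F = b_z(z) X c = la X b there, so F - la b belongs
to S.  On the other hand b is orthogonal to S (extremal_orthogonal): adding to b
an element of S changes neither b(z) nor X b(z), so if b were not orthogonal to
some s, a small step along s would lower the norm of b, and rescaling would then
beat the maximum.  Hence la b is in the orthogonal complement of S and F - la b is
orthogonal to that complement, i.e., la b is a projection of F, and projections
are unique on Omega (orthogonal_projection_unique).

The argument needs F to lie in the Bergman space, i.e., that the kernel series in
the basis h converges to a square integrable holomorphic function (kernel_A2).
This, like the uniqueness of projections, rests on the boundedness of point
evaluations on the Bergman space (A2_evaluation).  Bessel's inequality then makes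
the coefficients of the series square summable, the series converges locally
uniformly, its sum is holomorphic by weierstrass_convergence and square integrable
by Fatou's lemma.

Holomorphic means complex differentiable at each point, without continuity of the
derivative, so the analysis starts from Goursat's argument (goursat).  It yields
Cauchy's bound on the derivative at the centre of a square (cauchy_derivative),
which passes to several variables by restriction to complex lines
(cauchy_gradient, cauchy_lipschitz).  From the resulting Lipschitz bound the mean
square bound on point values follows without iterated integrals: at a point c
maximizing a weighted modulus |f| d^(n+1), d being the distance to the boundary of
a ball, |f| stays above |f c| / 2 on a ball of radius comparable to d
(weighted_maximum), whose volume bounds the integral of |f|^2 from below. *)

(** Quantified hypotheses are of no use to lra, which spends most of its time on
them in the larger contexts below. *)
Ltac arith :=
  repeat match goal with H : forall _, _ |- _ => clear H end; lra.

(** * Integrals over segments *)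

Section segment_integral.
Variable R : realType.
Implicit Types (f g : R -> R) (a b c m : R).
Local Notation mu := (@lebesgue_measure R).

Definition segint f a b : R := \int[mu]_(x in `[a, b]) f x.

Definition cont_seg f a b := {in `[a, b]%classic, continuous f}.

Lemma cont_segS f a b a' b' : a <= a' -> b' <= b ->
  cont_seg f a b -> cont_seg f a' b'.
Proof.
move=> aa' bb' cf x; rewrite inE/= in_itv/= => /andP[ax xb].
by apply: cf; rewrite inE/= in_itv/= (le_trans aa' ax) (le_trans xb bb').
Qed.

Lemma cont_seg_integrable f a b : cont_seg f a b ->
  mu.-integrable `[a, b] (EFin \o f).
Proof.
move=> cf; apply: continuous_compact_integrable; first exact: segment_compact.
exact: continuous_in_subspaceT.
Qed.

Lemma segint_split f a b c : a <= c -> c <= b -> cont_seg f a b ->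
  segint f a b = segint f a c + segint f c b.
Proof.
move=> ac cb cf; have fi := cont_seg_integrable cf; rewrite /segint.
have := @Rintegral_itvB R f (BLeft a) (BRight b) c fi.
rewrite !bnd_simp => /(_ ac cb) /eqP.
rewrite subr_eq addrC => /eqP ->; congr (_ + _).
apply: Rintegral_itv_obnd_cbnd.
apply: integrableS fi => //; apply: subset_itvr; rewrite bnd_simp.
exact: ac.
Qed.

Lemma lebesgue_segment a b : a <= b -> mu `[a, b]%classic = (b - a)%:E.
Proof.
move=> ab; rewrite (lebesgue_measure_itv `[a, b])/= lte_fin.
by case: ltP => // ba; rewrite (_ : b = a) ?subrr//; apply/eqP; rewrite eq_le ab ba.
Qed.

Lemma segint_ge f a b m : a <= b -> cont_seg f a b ->
  (forall x, a <= x <= b -> m <= f x) -> m * (b - a) <= segint f a b.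
Proof.
move=> ab cf fm.
have -> : m * (b - a) = segint (fun=> m) a b.
  rewrite /segint Rintegral_cst//.
  by congr (_ * _); rewrite -[LHS]/(fine (b - a)%:E); congr fine; rewrite -lebesgue_segment.
apply: le_Rintegral => //.
- by apply: cont_seg_integrable => x _; exact: cst_continuous.
- exact: cont_seg_integrable.
Qed.

Lemma segintB f g a b : cont_seg f a b -> cont_seg g a b ->
  segint (fun x => f x - g x) a b = segint f a b - segint g a b.
Proof. by move=> cf cg; apply: RintegralB => //; exact: cont_seg_integrable. Qed.

Lemma segint_le f a b m : a <= b -> cont_seg f a b ->
  (forall x, a <= x <= b -> f x <= m) -> segint f a b <= m * (b - a).
Proof.
move=> ab cf fm.
have c0 : cont_seg (fun=> 0 : R) a b by move=> x _; exact: cst_continuous.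
have int0 : segint (fun=> 0) a b = 0 by rewrite /segint Rintegral_cst ?mul0r.
have cN : cont_seg (fun x => 0 - f x) a b.
  by move=> x xab; apply: cvgB; [exact: cvg_cst|exact: cf].
have := segint_ge ab cN (m := - m).
rewrite segintB// int0 sub0r mulNr lerN2; apply => x xab.
by rewrite sub0r lerN2 fm.
Qed.

End segment_integral.

(** Closes goals that are linear in the integrals occurring in them, which become
variables of a new context. *)
Ltac segint_arith :=
  clear; repeat match goal with |- context [@segint ?R ?f ?a ?b] =>
    generalize (@segint R f a b) end; intros; lra.

(** * Goursat's theorem for rectangles *)

Section goursat.
Variable R : realType.
Implicit Types (P Q : R -> R -> R) (x y u v e d : R).

(** The form P dx + Q dy agrees at (x, y), to first order, with the differential of a
quadratic polynomial: the shared coefficient b expresses that the y-derivative of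
P is the x-derivative of Q. *)
Definition closed_form_at P Q x y := exists a b c : R, forall e : R, 0 < e ->
  exists2 d : R, 0 < d & forall x' y', `|x' - x| < d -> `|y' - y| < d ->
   `|P x' y' - P x y - a * (x' - x) - b * (y' - y)| <= e * (`|x' - x| + `|y' - y|)
   /\ `|Q x' y' - Q x y - b * (x' - x) - c * (y' - y)| <= e * (`|x' - x| + `|y' - y|).

Definition closed_form P Q x0 x1 y0 y1 := forall x y,
  x0 <= x <= x1 -> y0 <= y <= y1 -> closed_form_at P Q x y.

(** The integral of P dx + Q dy along the boundary of the rectangle,
counterclockwise. *)
Definition circulation P Q x0 x1 y0 y1 : R :=
  segint (P ^~ y0) x0 x1 + segint (Q x1) y0 y1
  - segint (P ^~ y1) x0 x1 - segint (Q x0) y0 y1.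

Lemma affine_approx_continuous (f : R -> R) x a : (forall e : R, 0 < e ->
  exists2 d : R, 0 < d & forall x', `|x' - x| < d ->
    `|f x' - f x - a * (x' - x)| <= e * `|x' - x|) -> {for x, continuous f}.
Proof.
move=> H; have [d d0 Hd] := H 1 ltr01.
apply/cvgrPdist_lt => e e0.
have a1 : 0 < `|a| + 1 by rewrite ltr_wpDl.
apply/nbhs_ballP; exists (Num.min d (e / (`|a| + 1))) => /=.
  by rewrite lt_min d0 divr_gt0.
move=> x'; rewrite /ball/= distrC lt_min ltr_pdivlMr// => /andP[/Hd + xe].
rewrite mul1r => H1; rewrite distrC; apply: le_lt_trans xe.
have -> : f x' - f x = (f x' - f x - a * (x' - x)) + a * (x' - x) by ring.
apply: (le_trans (ler_normD _ _)); rewrite [leRHS]mulrDr mulr1 [leRHS]addrC.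
by apply: lerD => //; rewrite normrM mulrC.
Qed.

Lemma closed_form_contP P Q x0 x1 y0 y1 y : closed_form P Q x0 x1 y0 y1 ->
  y0 <= y <= y1 -> cont_seg (P ^~ y) x0 x1.
Proof.
move=> cPQ yy x; rewrite inE/= in_itv/= => xx.
have [a [b [c H]]] := cPQ x y xx yy.
apply: (@affine_approx_continuous _ _ a) => e e0; have [d d0 Hd] := H e e0; exists d => // x' xd.
have [] := Hd x' y xd; first by rewrite subrr normr0.
by rewrite subrr mulr0 normr0 subr0 addr0.
Qed.

Lemma closed_form_contQ P Q x0 x1 y0 y1 x : closed_form P Q x0 x1 y0 y1 ->
  x0 <= x <= x1 -> cont_seg (Q x) y0 y1.
Proof.
move=> cPQ xx y; rewrite inE/= in_itv/= => yy.
have [a [b [c H]]] := cPQ x y xx yy.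
apply: (@affine_approx_continuous _ _ c) => e e0; have [d d0 Hd] := H e e0; exists d => // y' yd.
have [|_] := Hd x y' _ yd; first by rewrite subrr normr0.
by rewrite subrr mulr0 normr0 subr0 add0r.
Qed.

Lemma closed_formS P Q x0 x1 y0 y1 x0' x1' y0' y1' :
  x0 <= x0' -> x1' <= x1 -> y0 <= y0' -> y1' <= y1 ->
  closed_form P Q x0 x1 y0 y1 -> closed_form P Q x0' x1' y0' y1'.
Proof.
move=> h1 h2 h3 h4 c x y /andP[ha hb] /andP[hc hd]; apply: c; apply/andP; split; arith.
Qed.

Lemma circulation_splitx P Q x0 x1 y0 y1 x : x0 <= x <= x1 -> y0 <= y1 ->
  closed_form P Q x0 x1 y0 y1 ->
  circulation P Q x0 x1 y0 y1 =
  circulation P Q x0 x y0 y1 + circulation P Q x x1 y0 y1.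
Proof.
move=> /andP[xl xr] yy cPQ; rewrite /circulation.
rewrite (segint_split xl xr) ?(segint_split (f := P ^~ y1) xl xr).
- by ring.
- by apply: (closed_form_contP cPQ); rewrite yy lexx.
- by apply: (closed_form_contP cPQ); rewrite yy lexx.
Qed.

Lemma circulation_splity P Q x0 x1 y0 y1 y : x0 <= x1 -> y0 <= y <= y1 ->
  closed_form P Q x0 x1 y0 y1 ->
  circulation P Q x0 x1 y0 y1 =
  circulation P Q x0 x1 y0 y + circulation P Q x0 x1 y y1.
Proof.
move=> xx /andP[yl yr] cPQ; rewrite /circulation.
rewrite (segint_split yl yr) ?(segint_split (f := Q x0) yl yr).
- by ring.
- by apply: (closed_form_contQ cPQ); rewrite xx lexx.
- by apply: (closed_form_contQ cPQ); rewrite xx lexx.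
Qed.

(** The affine parts of P and Q contribute opposite multiples of the area, with the
shared coefficient b, so the circulation is at most the error of the affine
approximation times the perimeter. *)
Lemma circulation_small P Q x0 x1 y0 y1 x y : x0 <= x <= x1 -> y0 <= y <= y1 ->
  closed_form P Q x0 x1 y0 y1 -> forall e : R, 0 < e ->
  exists2 d : R, 0 < d & forall u0 u1 v0 v1,
    [/\ x0 <= u0, u1 <= x1, y0 <= v0 & v1 <= y1] ->
    u0 <= x <= u1 -> v0 <= y <= v1 -> u1 - u0 < d -> v1 - v0 < d ->
    `|circulation P Q u0 u1 v0 v1| <= e * ((u1 - u0) + (v1 - v0)) ^+ 2.
Proof.
move=> xx yy cPQ e e0; have e20 : 0 < e / 2 by arith.
have [a [b [c H]]] := cPQ x y xx yy; have [d d0 Hd] := H _ e20.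
exists d => // u0 u1 v0 v1 [h1 h2 h3 h4] /andP[ux xu] /andP[vy yv] ud vd.
have cPQ' : closed_form P Q u0 u1 v0 v1 by apply: closed_formS cPQ.
set s := (u1 - u0) + (v1 - v0).
have uu : u0 <= u1 by arith.
have vv : v0 <= v1 by arith.
have bd x' y' : u0 <= x' <= u1 -> v0 <= y' <= v1 ->
    `|P x' y' - P x y - a * (x' - x) - b * (y' - y)| <= e / 2 * s /\
    `|Q x' y' - Q x y - b * (x' - x) - c * (y' - y)| <= e / 2 * s.
  move=> /andP[l1 l2] /andP[l3 l4].
  have xn : `|x' - x| <= u1 - u0 by rewrite ler_norml; arith.
  have yn : `|y' - y| <= v1 - v0 by rewrite ler_norml; arith.
  have [||k1 k2] := Hd x' y'; [arith|arith|].
  have ss : e / 2 * (`|x' - x| + `|y' - y|) <= e / 2 * s.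
    by rewrite ler_pM2l// /s lerD.
  by split; [apply: le_trans k1 _|apply: le_trans k2 _].
have v0in : v0 <= v0 <= v1 by rewrite lexx.
have v1in : v0 <= v1 <= v1 by rewrite lexx vv.
have u0in : u0 <= u0 <= u1 by rewrite lexx.
have u1in : u0 <= u1 <= u1 by rewrite lexx uu.
have cP0 := closed_form_contP cPQ' v0in.
have cP1 := closed_form_contP cPQ' v1in.
have cQ0 := closed_form_contQ cPQ' u0in.
have cQ1 := closed_form_contQ cPQ' u1in.
have cP : cont_seg (fun t => P t v0 - P t v1) u0 u1.
  by move=> t tu; apply: cvgB; [exact: cP0|exact: cP1].
have cQ : cont_seg (fun t => Q u1 t - Q u0 t) v0 v1.
  by move=> t tu; apply: cvgB; [exact: cQ1|exact: cQ0].
have := segint_ge uu cP (m := - b * (v1 - v0) - e * s).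
rewrite segintB// => /(_ _)/wrap[].
  by move=> t tu; have [] := bd t v0 tu v0in; have [] := bd t v1 tu v1in;
    rewrite !ler_norml; arith.
have := segint_le uu cP (m := - b * (v1 - v0) + e * s).
rewrite segintB// => /(_ _)/wrap[].
  by move=> t tu; have [] := bd t v0 tu v0in; have [] := bd t v1 tu v1in;
    rewrite !ler_norml; arith.
have := segint_ge vv cQ (m := b * (u1 - u0) - e * s).
rewrite segintB// => /(_ _)/wrap[].
  by move=> t tu; have [_] := bd u0 t u0in tu; have [_] := bd u1 t u1in tu;
    rewrite !ler_norml; arith.
have := segint_le vv cQ (m := b * (u1 - u0) + e * s).
rewrite segintB// => /(_ _)/wrap[].
  by move=> t tu; have [_] := bd u0 t u0in tu; have [_] := bd u1 t u1in tu;
    rewrite !ler_norml; arith.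
move=> k1 k2 k3 k4; rewrite ler_norml /circulation expr2.
by move: k1 k2 k3 k4; rewrite /s; nra.
Qed.

(** The common point is the supremum of the left endpoints. *)
Lemma nested_segments (u v : nat -> R) : (forall k, u k <= u k.+1) ->
  (forall k, v k.+1 <= v k) -> (forall k, u k <= v k) ->
  exists l, forall k, u k <= l <= v k.
Proof.
move=> iu dv uv.
have iu' : nondecreasing_seq u by apply/nondecreasing_seqP.
have dv' : nonincreasing_seq v by apply/nonincreasing_seqP.
have uvk j k : u j <= v k.
  have [jk|/ltnW kj] := leqP j k; first exact: le_trans (iu' _ _ jk) (uv _).
  exact: le_trans (uv _) (dv' _ _ kj).
have hs : has_sup (range u).
  by split; [exists (u 0%N), 0%N|exists (v 0%N) => _ [j _ <-]].
exists (sup (range u)) => k; apply/andP; split.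
  by apply: sup_upper_bound => //; exists k.
by apply: ge_sup => [|_ [j _ <-]]; [case: hs|exact: uvk].
Qed.

(** Cousin's principle: a property of rectangles that passes from the four quarters
to the whole and holds for all small rectangles around each point holds
everywhere.  Otherwise some quarter of each bad rectangle is bad, and the bad
quarters shrink to a point. *)
Lemma bisection (S : R -> R -> R -> R -> Prop) x0 x1 y0 y1 :
  x0 <= x1 -> y0 <= y1 ->
  (forall u0 u1 v0 v1 u v, [/\ x0 <= u0, u1 <= x1, y0 <= v0 & v1 <= y1] ->
     u0 <= u1 -> v0 <= v1 -> u = (u0 + u1) / 2 -> v = (v0 + v1) / 2 ->
     S u0 u v0 v -> S u u1 v0 v -> S u0 u v v1 -> S u u1 v v1 -> S u0 u1 v0 v1) ->
  (forall x y, x0 <= x <= x1 -> y0 <= y <= y1 ->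
     exists2 d : R, 0 < d & forall u0 u1 v0 v1,
      [/\ x0 <= u0, u1 <= x1, y0 <= v0 & v1 <= y1] ->
      u0 <= x <= u1 -> v0 <= y <= v1 -> u1 - u0 < d -> v1 - v0 < d ->
      S u0 u1 v0 v1) ->
  S x0 x1 y0 y1.
Proof.
move=> xx yy step loc; apply: contrapT => nS.
pose T := {p : R * R * R * R | let: (u0, u1, v0, v1) := p in
  [/\ x0 <= u0 <= u1, u1 <= x1, y0 <= v0 <= v1, v1 <= y1 & ~ S u0 u1 v0 v1]}.
pose a (t : T) := (sval t).1.1.1; pose b (t : T) := (sval t).1.1.2.
pose c (t : T) := (sval t).1.2; pose d (t : T) := (sval t).2.
have nxt (t : T) : {t' : T | [/\ a t <= a t', b t' <= b t, c t <= c t', d t' <= d t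
   & b t' - a t' = (b t - a t) / 2 /\ d t' - c t' = (d t - c t) / 2]}.
  apply: cid; case: t => -[[[u0 u1] v0] v1] /= Ht.
  have [/andP[h1 h1'] h2 /andP[h3 h3'] h4 nSt] := Ht.
  set u := (u0 + u1) / 2; set v := (v0 + v1) / 2.
  have uE : u = (u0 + u1) / 2 by []; have vE : v = (v0 + v1) / 2 by [].
  have [S1|/not_implyP[S1 nS1]] := pselect (S u0 u v0 v -> S u u1 v0 v -> ~ S u0 u v v1).
    have [N1|N1] := pselect (S u0 u v0 v); last first.
      have H : [/\ x0 <= u0 <= u, u <= x1, y0 <= v0 <= v, v <= y1 & ~ S u0 u v0 v].
        by split=> //; rewrite ?uE ?vE; arith.
      by exists (exist _ (u0, u, v0, v) H); rewrite /a /b /c /d /= uE vE; split; try arith; split; arith.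
    have [N2|N2] := pselect (S u u1 v0 v); last first.
      have H : [/\ x0 <= u <= u1, u1 <= x1, y0 <= v0 <= v, v <= y1 & ~ S u u1 v0 v].
        by split=> //; rewrite ?uE ?vE; arith.
      by exists (exist _ (u, u1, v0, v) H); rewrite /a /b /c /d /= uE vE; split; try arith; split; arith.
    have N3 := S1 N1 N2.
    have H : [/\ x0 <= u0 <= u, u <= x1, y0 <= v <= v1, v1 <= y1 & ~ S u0 u v v1].
      by split=> //; rewrite ?uE ?vE; arith.
    by exists (exist _ (u0, u, v, v1) H); rewrite /a /b /c /d /= uE vE; split; try arith; split; arith.
  move: nS1 => /not_implyP[S2 /contrapT S3].
  have N4 : ~ S u u1 v v1.
    by move=> S4; apply: nSt; apply: (step u0 u1 v0 v1 u v).
  have H : [/\ x0 <= u <= u1, u1 <= x1, y0 <= v <= v1, v1 <= y1 & ~ S u u1 v v1].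
    by split=> //; rewrite ?uE ?vE; arith.
  by exists (exist _ (u, u1, v, v1) H); rewrite /a /b /c /d /= uE vE; split; try arith; split; arith.
have H0 : [/\ x0 <= x0 <= x1, x1 <= x1, y0 <= y0 <= y1, y1 <= y1 & ~ S x0 x1 y0 y1].
  by split=> //; rewrite lexx.
pose t0 : T := exist _ (x0, x1, y0, y1) H0.
pose t k := iter k (fun t => sval (nxt t)) t0.
have tS k : [/\ a (t k) <= a (t k.+1), b (t k.+1) <= b (t k), c (t k) <= c (t k.+1),
    d (t k.+1) <= d (t k) & b (t k.+1) - a (t k.+1) = (b (t k) - a (t k)) / 2 /\
    d (t k.+1) - c (t k.+1) = (d (t k) - c (t k)) / 2].
  by rewrite /t /= -/(t k); case: (nxt (t k)).
have tP k : [/\ x0 <= a (t k) <= b (t k), b (t k) <= x1, y0 <= c (t k) <= d (t k),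
    d (t k) <= y1 & ~ S (a (t k)) (b (t k)) (c (t k)) (d (t k))].
  by rewrite /a /b /c /d; case: (t k) => -[[[? ?] ?] ?].
have wE k : b (t k) - a (t k) = (x1 - x0) / 2 ^+ k /\
            d (t k) - c (t k) = (y1 - y0) / 2 ^+ k.
  elim: k => [|k [IH1 IH2]]; first by rewrite /a/b/c/d/= expr0 !divr1.
  have [_ _ _ _ [-> ->]] := tS k; rewrite IH1 IH2 exprS.
  by split; field; rewrite expf_neq0.
have [||| x Hx] := @nested_segments (a \o t) (b \o t).
- by move=> k; case: (tS k).
- by move=> k; case: (tS k).
- by move=> k /=; have [/andP[]] := tP k.
have [||| y Hy] := @nested_segments (c \o t) (d \o t).
- by move=> k; case: (tS k).
- by move=> k; case: (tS k).
- by move=> k /=; have [_ _ /andP[]] := tP k.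
have [dl dl0 Hd] := loc x y (Hx 0%N) (Hy 0%N).
have small (w : R) : \forall k \near \oo, w / 2 ^+ k < dl.
  near=> k; apply: le_lt_trans (ler_norm _) _.
  suff : `|0 - w / 2 ^+ k| < dl by rewrite sub0r normrN.
  near: k; apply: cvgr_dist_lt dl0; rewrite -(mulr0 w); apply: cvgMr.
  under eq_fun do rewrite -exprVn.
  by apply: cvg_expr; rewrite ger0_norm ?invr_ge0// invf_lt1 ?ltr1n.
have [k [k1 k2]] : exists k, (x1 - x0) / 2 ^+ k < dl /\ (y1 - y0) / 2 ^+ k < dl.
  have [k _ kP] : \forall k \near \oo, (x1 - x0) / 2 ^+ k < dl /\ (y1 - y0) / 2 ^+ k < dl.
    by apply: filterI; exact: small.
  by exists k; apply: kP => /=.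
have [/andP[h1 _] h2 /andP[h3 _] h4 nSk] := tP k; apply: nSk.
have [w1 w2] := wE k.
by apply: Hd; [split|exact: Hx|exact: Hy|rewrite w1|rewrite w2].
Unshelve. all: by end_near. Qed.

(** The bound by e times the square of half the perimeter is additive under
quartering, hence extends from small rectangles to all of them by bisection. *)
Lemma goursat P Q x0 x1 y0 y1 : x0 <= x1 -> y0 <= y1 ->
  closed_form P Q x0 x1 y0 y1 -> circulation P Q x0 x1 y0 y1 = 0.
Proof.
move=> xx yy cPQ.
have bd e : 0 < e ->
    `|circulation P Q x0 x1 y0 y1| <= e * ((x1 - x0) + (y1 - y0)) ^+ 2.
  move=> e0; pose S u0 u1 v0 v1 :=
    `|circulation P Q u0 u1 v0 v1| <= e * ((u1 - u0) + (v1 - v0)) ^+ 2.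
  apply: (@bisection S) => //; last first.
    by move=> x y hx hy; exact: circulation_small.
  move=> u0 u1 v0 v1 u v [h1 h2 h3 h4] uu vv uE vE; rewrite /S => S1 S2 S3 S4.
  have uin : u0 <= u <= u1 by rewrite uE; arith.
  have vin : v0 <= v <= v1 by rewrite vE; arith.
  have /andP[ul ur] := uin; have /andP[vl vr] := vin.
  have cf : closed_form P Q u0 u1 v0 v1 by exact: closed_formS cPQ.
  rewrite (circulation_splitx uin vv cf).
  rewrite (circulation_splity ul vin (closed_formS (lexx _) ur (lexx _) (lexx _) cf)).
  rewrite (circulation_splity ur vin (closed_formS ul (lexx _) (lexx _) (lexx _) cf)).
  have E1 : e * (u1 - u0 + (v1 - v0)) ^+ 2 =
    e * (u - u0 + (v - v0)) ^+ 2 + e * (u - u0 + (v1 - v)) ^+ 2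
    + (e * (u1 - u + (v - v0)) ^+ 2 + e * (u1 - u + (v1 - v)) ^+ 2).
    by rewrite uE vE; field.
  rewrite E1; apply: le_trans (ler_normD _ _) _; apply: lerD;
  by apply: le_trans (ler_normD _ _) _; apply: lerD.
apply/eqP; rewrite -normr_le0; apply/ler_addgt0Pr => e e0; rewrite add0r.
set s := (x1 - x0 + (y1 - y0)) ^+ 2 in bd.
have s0 : 0 <= s by rewrite sqr_ge0.
have := bd (e / (s + 1)) _; rewrite divr_gt0//; last arith.
move/(_ isT) => h; apply: (le_trans h); rewrite mulrAC ler_pdivrMr; last arith.
by rewrite ler_pM2l//; arith.
Qed.

End goursat.

(** * Real-valued modulus and norm, and complex differentiability *)

Section modulus.
Variable R : realType.
Local Notation C := (Cplx R).
Local Notation Re := (@complex.Re R).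
Local Notation Im := (@complex.Im R).
Implicit Types (x y : C) (a b : R).

(** The inclusion of the reals, with values in Cplx R rather than R[i], so that the
rules below apply to the structures carried by Cplx R. *)
Definition rc a : C := Complex a 0.
Definition cabs x : R := Re `|x|.

Lemma complex_ext x y : Re x = Re y -> Im x = Im y -> x = y.
Proof. by case: x y => [? ?] [? ?] /= -> ->. Qed.

Lemma creD x y : Re (x + y) = Re x + Re y. Proof. by case: x y => [? ?] []. Qed.
Lemma cimD x y : Im (x + y) = Im x + Im y. Proof. by case: x y => [? ?] []. Qed.
Lemma creN x : Re (- x) = - Re x. Proof. by case: x. Qed.
Lemma cimN x : Im (- x) = - Im x. Proof. by case: x. Qed.
Lemma creM x y : Re (x * y) = Re x * Re y - Im x * Im y.
Proof. by case: x y => [? ?] []. Qed.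
Lemma cimM x y : Im (x * y) = Re x * Im y + Im x * Re y.
Proof. by case: x y => [? ?] []. Qed.
Lemma creJ x : Re x^* = Re x. Proof. by case: x. Qed.
Lemma cimJ x : Im x^* = - Im x. Proof. by case: x. Qed.
Lemma creV x : Re x^-1 = Re x / (Re x ^+ 2 + Im x ^+ 2). Proof. by case: x. Qed.
Lemma cimV x : Im x^-1 = - Im x / (Re x ^+ 2 + Im x ^+ 2).
Proof. by case: x => ? ? /=; rewrite mulNr. Qed.

Lemma rc0 : rc 0 = 0. Proof. by []. Qed.
Lemma rc1 : rc 1 = 1. Proof. by []. Qed.
Lemma rcD a b : rc (a + b) = rc a + rc b.
Proof. by apply: complex_ext; rewrite ?creD ?cimD/= ?addr0. Qed.
Lemma rcM a b : rc (a * b) = rc a * rc b.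
Proof. by apply: complex_ext; rewrite ?creM ?cimM/= ?mul0r ?mulr0 ?subr0 ?addr0. Qed.
Lemma rc_le a b : (rc a <= rc b) = (a <= b). Proof. exact: lecR. Qed.
Lemma rc_lt a b : (rc a < rc b) = (a < b). Proof. exact: ltcR. Qed.
Lemma rc_inj : injective rc. Proof. by move=> a b []. Qed.

Lemma cabsE x : `|x| = rc (cabs x).
Proof. by rewrite /cabs /rc; have := normc_def (x : R[i]); move=> ->. Qed.

Lemma cabs_sqrt x : cabs x = Num.sqrt (Re x ^+ 2 + Im x ^+ 2).
Proof. by rewrite /cabs; have := normc_def (x : R[i]); move=> ->. Qed.

Lemma cabs_sqr x : cabs x ^+ 2 = Re x ^+ 2 + Im x ^+ 2.
Proof. by rewrite cabs_sqrt sqr_sqrtr// addr_ge0// sqr_ge0. Qed.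

Lemma cabs_ge0 x : 0 <= cabs x. Proof. by rewrite cabs_sqrt sqrtr_ge0. Qed.
#[local] Hint Resolve cabs_ge0 : core.

Lemma cabs0 : cabs 0 = 0. Proof. by rewrite /cabs normr0. Qed.
Lemma cabs1 : cabs 1 = 1. Proof. by rewrite /cabs normr1. Qed.
Lemma cabsN x : cabs (- x) = cabs x. Proof. by rewrite /cabs normrN. Qed.
Lemma cabsB x y : cabs (x - y) = cabs (y - x). Proof. by rewrite /cabs distrC. Qed.
Lemma cabsM x y : cabs (x * y) = cabs x * cabs y.
Proof. by apply: rc_inj; rewrite rcM -!cabsE normrM. Qed.
Lemma cabsV x : cabs x^-1 = (cabs x)^-1.
Proof.
have [->|x0] := eqVneq x 0; first by rewrite invr0 cabs0 invr0.
have c0 : cabs x != 0.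
  by apply: contra_neq x0 => c0; apply/normr0_eq0; rewrite cabsE c0.
by apply: (mulfI c0); rewrite -cabsM !divff// cabs1.
Qed.
Lemma cabs_eq0 x : (cabs x == 0) = (x == 0).
Proof.
apply/eqP/eqP => [c0|->]; last exact: cabs0.
by apply/normr0_eq0; rewrite cabsE c0.
Qed.
Lemma cabsD x y : cabs (x + y) <= cabs x + cabs y.
Proof. by rewrite -rc_le rcD -!cabsE ler_normD. Qed.
Lemma cabs_rc a : cabs (rc a) = `|a|.
Proof. by rewrite cabs_sqrt /= expr0n addr0 sqrtr_sqr. Qed.
Lemma cabsJ x : cabs x^* = cabs x.
Proof. by rewrite !cabs_sqrt creJ cimJ sqrrN. Qed.

Lemma Re_cabs x : `|Re x| <= cabs x.
Proof. by rewrite cabs_sqrt -sqrtr_sqr ler_wsqrtr// lerDl sqr_ge0. Qed.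
Lemma Im_cabs x : `|Im x| <= cabs x.
Proof. by rewrite cabs_sqrt -sqrtr_sqr ler_wsqrtr// lerDr sqr_ge0. Qed.
Lemma cabs_ReIm x : cabs x <= `|Re x| + `|Im x|.
Proof.
rewrite -(@ler_pXn2r _ 2)// ?nnegrE ?addr_ge0// cabs_sqr sqrrD !real_normK ?num_real//.
by have := mulr_ge0 (normr_ge0 (Re x)) (normr_ge0 (Im x)); arith.
Qed.

(** In the partial order of the complex numbers only positive reals are positive. *)
Lemma cposP (e : C) : 0 < e -> exists2 r : R, 0 < r & e = rc r.
Proof.
case: e => a b; rewrite (_ : 0 = rc 0)// => H.
have := H; rewrite ltcE/= => /andP[/eqP b0 a0].
by exists a => //; rewrite b0.
Qed.

Lemma rc_gt0 a : (0 < rc a) = (0 < a). Proof. by rewrite -rc0 rc_lt. Qed.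
Lemma rc_ge0 a : (0 <= rc a) = (0 <= a). Proof. by rewrite -rc0 rc_le. Qed.

Section vector_norm.
Variable V : normedModType C.
Implicit Types v w : V.

(** The norm of a complex normed space takes complex values that are nonnegative
reals. *)
Definition rnorm v : R := Re `|v|.

Lemma rnormE v : `|v| = rc (rnorm v).
Proof.
have := normr_ge0 v.
rewrite /rnorm; case: (`|v|) => a b.
by rewrite (_ : 0 = rc 0)// lecE/= => /andP[/eqP-> _].
Qed.
Lemma rnorm_ge0 v : 0 <= rnorm v.
Proof. by rewrite -rc_ge0 -rnormE normr_ge0. Qed.
Lemma rnormD v w : rnorm (v + w) <= rnorm v + rnorm w.
Proof. by rewrite -rc_le rcD -!rnormE ler_normD. Qed.
Lemma rnormB v w : rnorm (v - w) = rnorm (w - v). Proof. by rewrite /rnorm distrC. Qed.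
Lemma rnorm0 : rnorm 0 = 0. Proof. by rewrite /rnorm normr0. Qed.
Lemma rnormZ x v : rnorm (x *: v) = cabs x * rnorm v.
Proof. by apply: rc_inj; rewrite rcM -cabsE -!rnormE normrZ. Qed.
Lemma rnorm_eq0 v : rnorm v = 0 -> v = 0.
Proof. by move=> v0; apply/normr0_eq0; rewrite rnormE v0. Qed.

Lemma nbhs_rnormP v (P : set V) :
  nbhs v P <-> exists2 d : R, 0 < d & forall w, rnorm (w - v) < d -> P w.
Proof.
split=> [/nbhs_ballP[e /= /cposP[r r0 ->]] H|[d d0 H]].
  exists r => // w wv; apply: H; rewrite -ball_normE/= rnormE rc_lt rnormB//.
apply/nbhs_ballP; exists (rc d) => /=; first by rewrite rc_gt0.
by move=> w; rewrite -ball_normE/= rnormE rc_lt rnormB; exact: H.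
Qed.

End vector_norm.

Lemma open_rnormP (V : normedModType C) (A : set V) v : open A -> A v ->
  exists2 d : R, 0 < d & forall w, rnorm (w - v) < d -> A w.
Proof. by move=> oA Av; apply/nbhs_rnormP; exact: open_nbhs_nbhs. Qed.

Lemma cvg_cabsP (T : Type) (F : set_system T) {FF : Filter F} (f : T -> C) (l : C) :
  f @ F --> l <-> forall e : R, 0 < e -> \forall x \near F, cabs (f x - l) < e.
Proof.
split=> [/cvgrPdist_lt H e e0|H].
  have := H (rc e); rewrite rc_gt0 => /(_ e0); apply: filterS => x.
  by rewrite cabsE rc_lt cabsB.
apply/cvgrPdist_lt => _ /cposP[e e0 ->]; apply: filterS (H e e0) => x.
by rewrite cabsE rc_lt cabsB.
Qed.

Lemma continuous_cabsP (V : normedModType C) (f : V -> C) v :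
  {for v, continuous f} <-> forall e : R, 0 < e ->
    exists2 d : R, 0 < d & forall w, rnorm (w - v) < d -> cabs (f w - f v) < e.
Proof.
split=> [/cvg_cabsP H e e0|H].
  by have /nbhs_rnormP[d d0 Hd] := H e e0; exists d.
by apply/cvg_cabsP => e e0; apply/nbhs_rnormP; exact: H.
Qed.

Lemma differentiable_smallo (V : normedModType C) (f : V -> C) v :
  differentiable f v -> forall e : R, 0 < e -> exists2 d : R, 0 < d &
    forall h, rnorm h < d -> cabs (f (v + h) - f v - 'd f v h) <= e * rnorm h.
Proof.
move=> df e e0.
have [_ /eqaddoP H] := (diff_locallyP _ _).1 df.
have /H/nbhs_rnormP[d d0 Hd] : 0 < rc e by rewrite rc_gt0.
exists d => // h hd; have := Hd h; rewrite subr0 => /(_ hd) /=.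
have -> : (f \o shift v - (cst (f v) + 'd f v)) h = f (v + h) - f v - 'd f v h.
  by rewrite [v + h]addrC -addrA -opprD.
by rewrite !rnormE -rcM rc_le.
Qed.

(** Converse of differentiable_smallo: any continuous linear first-order
approximation is the differential. *)
Lemma smallo_differentiable (V : normedModType C) (f : V -> C) v
    (df : V -> C) : linear df -> continuous df ->
  (forall e : R, 0 < e -> exists2 d : R, 0 < d &
    forall h, rnorm h < d -> cabs (f (v + h) - f v - df h) <= e * rnorm h) ->
  differentiable f v.
Proof.
move=> ldf cdf H.
pose dfM := GRing.isLinear.Build _ _ _ _ _ ldf.
pose dfL : {linear _ -> _} := HB.pack df dfM.
have E : f \o shift v = cst (f v) + df +o_ 0 id.
  apply/eqaddoP => _ /cposP[e e0 ->].
  have [d d0 Hd] := H e e0; apply/nbhs_rnormP; exists d => // h; rewrite subr0.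
  move=> /Hd; have -> : f (v + h) - f v - df h = (f \o shift v - (cst (f v) + df)) h.
    by rewrite [v + h]addrC -addrA -opprD.
  by rewrite !rnormE -rcM rc_le.
have dE := @diff_unique _ _ _ _ dfL _ cdf E.
by apply/diff_locallyP; rewrite dE; split.
Qed.

Definition has_cderiv (g : C -> C) (t D : C) := forall e : R, 0 < e ->
  exists2 d : R, 0 < d & forall h, cabs h < d ->
    cabs (g (t + h) - g t - D * h) <= e * cabs h.

Lemma has_cderiv_slice (V : normedModType C) (f : V -> C) (a v : V) (t : C) :
  differentiable f (a + t *: v) ->
  has_cderiv (fun s => f (a + s *: v)) t ('d f (a + t *: v) v).
Proof.
move=> /differentiable_smallo H e e0.
have v1 : 0 < rnorm v + 1 by have := rnorm_ge0 v; arith.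
have [d d0 Hd] := H _ (divr_gt0 e0 v1).
exists (d / (rnorm v + 1)); first exact: divr_gt0.
move=> h; rewrite ltr_pdivlMr// => hd.
have hv : rnorm (h *: v) <= cabs h * (rnorm v + 1).
  by rewrite rnormZ ler_wpM2l// lerDl.
have := Hd (h *: v) (le_lt_trans hv hd).
rewrite scalerDl addrA linearZ/= -[h *: 'd f _ v]/(h * _) mulrC => /le_trans; apply.
by rewrite mulrAC ler_pdivrMr// -mulrA ler_pM2l.
Qed.

Lemma differentiable_has_cderiv (g : C -> C) t :
  differentiable g t -> has_cderiv g t ('D_1 g t).
Proof.
move=> dg e e0; have [d d0 Hd] := differentiable_smallo dg e0.
exists d => // h hd; have := Hd h hd; rewrite deriveE//.
by rewrite -[h in 'd g t h](mulr1) -[h * 1]/(h *: 1) linearZ/= -[_ *: _]/(h * _) mulrC.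
Qed.

Lemma has_cderiv_differentiable (g : C -> C) t D :
  has_cderiv g t D -> differentiable g t.
Proof.
move=> H; apply: (@smallo_differentiable C g t (fun h => h *: D)).
- by move=> k u v; rewrite scalerDl scalerA.
- exact: scalel_continuous.
move=> e e0; have [d d0 Hd] := H e e0; exists d => // h hd.
by have := Hd h hd; rewrite [D * h]mulrC.
Qed.

End modulus.
#[local] Hint Resolve cabs_ge0 rnorm_ge0 : core.

(** * Cauchy's estimate in one variable *)

Section cauchy_derivative.
Variable R : realType.
Local Notation C := (Cplx R).
Local Notation Re := (@complex.Re R).
Local Notation Im := (@complex.Im R).

(** The Cauchy-Riemann equations: F dt = (u + i v)(dx + i dy) has imaginary part
v dx + u dy. *)
Lemma has_cderiv_closed_form (F : C -> C) (x y : R) D :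
  has_cderiv F (Complex x y) D ->
  closed_form_at (fun x y => Im (F (Complex x y)))
                 (fun x y => Re (F (Complex x y))) x y.
Proof.
move=> H; exists (Im D), (Re D), (- Im D) => e e0.
have [d d0 Hd] := H e e0; exists (d / 2); first by rewrite divr_gt0.
move=> x' y' hx hy; pose h : C := Complex (x' - x) (y' - y).
have hE : (Complex x y : C) + h = Complex x' y'.
  by apply: complex_ext; rewrite ?creD ?cimD/= addrC subrK.
have habs : cabs h <= `|x' - x| + `|y' - y| by exact: cabs_ReIm.
have := Hd h (_ : cabs h < d); rewrite hE => /(_ _)/wrap[].
  by apply: (le_lt_trans habs); arith.
set E := _ - D * h => hh.
have EE : cabs E <= e * (`|x' - x| + `|y' - y|).
  by apply: (le_trans hh); rewrite ler_pM2l.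
have ImE : Im E = Im (F (Complex x' y')) - Im (F (Complex x y))
    - Im D * (x' - x) - Re D * (y' - y).
  by rewrite /E !cimD !cimN cimM /=; ring.
have ReE : Re E = Re (F (Complex x' y')) - Re (F (Complex x y))
    - Re D * (x' - x) - - Im D * (y' - y).
  by rewrite /E !creD !creN creM /=; ring.
by split; rewrite -?ImE -?ReE; [apply: le_trans (Im_cabs _) _|apply: le_trans (Re_cabs _) _].
Qed.

(** The frame between the two squares is cut into four rectangles, which avoid the
singularities inside the small square. *)
Lemma circulation_frame (P Q : R -> R -> R) (e r : R) : 0 < e -> e <= r ->
  (forall x y, `|x| <= r -> `|y| <= r -> e <= `|x| \/ e <= `|y| ->
     closed_form_at P Q x y) ->
  circulation P Q (- r) r (- r) r = circulation P Q (- e) e (- e) e.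
Proof.
move=> e0 er cf.
have cfr x0 x1 y0 y1 : - r <= x0 -> x1 <= r -> - r <= y0 -> y1 <= r ->
    (x1 <= - e \/ e <= x0) \/ (y1 <= - e \/ e <= y0) -> closed_form P Q x0 x1 y0 y1.
  move=> h1 h2 h3 h4 h5 x y /andP[k1 k2] /andP[k3 k4].
  have xr : `|x| <= r by rewrite ler_norml; arith.
  have yr : `|y| <= r by rewrite ler_norml; arith.
  apply: cf => //; rewrite !ler_normr; case: h5 => -[] h5.
  - by left; apply/orP; right; arith.
  - by left; apply/orP; left; arith.
  - by right; apply/orP; right; arith.
  - by right; apply/orP; left; arith.
have gs x0 x1 y0 y1 : - r <= x0 -> x1 <= r -> - r <= y0 -> y1 <= r ->
    x0 <= x1 -> y0 <= y1 ->
    (x1 <= - e \/ e <= x0) \/ (y1 <= - e \/ e <= y0) -> circulation P Q x0 x1 y0 y1 = 0.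
  by move=> h1 h2 h3 h4 h5 h6 h7; apply: goursat => //; exact: cfr.
have Nre : - r <= - e by rewrite lerN2.
have Nee : - e <= e by rewrite ge0_cp// ltW.
have Nrr : - r <= r by apply: le_trans (le_trans Nre Nee) er.
have Nr_e : - r <= e := le_trans Nre Nee.
have Ne_r : - e <= r := le_trans Nee er.
have L := gs (- r) (- e) (- r) r (lexx _) Ne_r (lexx _) (lexx _) Nre Nrr
  (or_introl (or_introl (lexx _))).
have Rg := gs e r (- r) r Nr_e (lexx _) (lexx _) (lexx _) er Nrr
  (or_introl (or_intror (lexx _))).
have T := gs (- e) e e r Nre er Nr_e (lexx _) Nee er (or_intror (or_intror (lexx _))).
have B := gs (- e) e (- r) (- e) Nre er (lexx _) Ne_r Nee Nre
  (or_intror (or_introl (lexx _))).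
have splitP y : (y <= - e \/ e <= y) -> - r <= y <= r ->
    segint (P ^~ y) (- r) r = segint (P ^~ y) (- r) (- e)
      + (segint (P ^~ y) (- e) e + segint (P ^~ y) e r).
  move=> hy /andP[hy1 hy2].
  have cP : cont_seg (P ^~ y) (- r) r.
    apply: (@closed_form_contP _ P Q (- r) r y y y); last by rewrite lexx.
    by apply: cfr; arith.
  rewrite (@segint_split _ _ (- r) r (- e)); try arith; last exact: cP.
  rewrite (@segint_split _ _ (- e) r e) //; try arith.
  by apply: cont_segS cP; arith.
have splitQ x : (x <= - e \/ e <= x) -> - r <= x <= r ->
    segint (Q x) (- r) r = segint (Q x) (- r) (- e)
      + (segint (Q x) (- e) e + segint (Q x) e r).
  move=> hx /andP[hx1 hx2].
  have cQ : cont_seg (Q x) (- r) r.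
    apply: (@closed_form_contQ _ P Q x x (- r) r x); last by rewrite lexx.
    by apply: cfr; arith.
  rewrite (@segint_split _ _ (- r) r (- e)); try arith; last exact: cQ.
  rewrite (@segint_split _ _ (- e) r e) //; try arith.
  by apply: cont_segS cQ; arith.
have rin : - r <= r <= r by rewrite Nrr lexx.
have Nrin : - r <= - r <= r by rewrite Nrr lexx.
have ein : - r <= e <= r by rewrite Nr_e er.
have Nein : - r <= - e <= r by rewrite Nre Ne_r.
have P1 := splitP r (or_intror er) rin; have P2 := splitP (- r) (or_introl Nre) Nrin.
have Q1 := splitQ e (or_intror (lexx _)) ein.
have Q2 := splitQ (- e) (or_introl (lexx _)) Nein.
move: L Rg T B; rewrite /circulation P1 P2 Q1 Q2.
segint_arith.
Qed.

(** Integrate (g t - g 0) / t^2, after a rotation making the derivative at 0 a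
positive real d, around squares centred at 0.  The circulation is at most
16 M / r on the square of half-side r.  On a small square the integrand is close to
d / t, whose circulation is at least 4 d; the two circulations agree by
circulation_frame. *)
Lemma cauchy_derivative (g : C -> C) (r M : R) (D : C) : 0 < r ->
  has_cderiv g 0 D ->
  (forall t : C, `|Re t| <= r -> `|Im t| <= r -> differentiable g t) ->
  (forall t : C, `|Re t| <= r -> `|Im t| <= r -> cabs (g t) <= M) ->
  cabs D <= 4 * M / r.
Proof.
move=> r0 gD dg gM.
have [->|D0] := eqVneq D 0.
  rewrite cabs0 divr_ge0 ?(ltW r0)// mulr_ge0//.
  by apply: le_trans (cabs_ge0 (g 0)) (gM _ _ _); rewrite normr0 ltW.
set d := cabs D.
have d0 : 0 < d by rewrite lt_def cabs_ge0 cabs_eq0 D0.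
(* a unimodular factor making the derivative at 0 a positive real *)
have [u uD u1] : exists2 u : C, u * D = rc d & cabs u = 1.
  exists (rc d / D); first by rewrite divfK.
  by rewrite cabsM cabsV cabs_rc gtr0_norm// divff// gt_eqF.
pose w (t : C) : C := u * (g t - g 0).
pose F (t : C) : C := w t * (t ^-1 * t ^-1).
have dF (t : C) : t != 0 -> `|Re t| <= r -> `|Im t| <= r -> differentiable F t.
  move=> t0 rt it; have dgt := dg t rt it.
  have dV : differentiable (fun t : C => t^-1) t by exact: differentiable_Rinv.
  apply: differentiableM; last exact: differentiableM.
  exact: (differentiableM (differentiable_cst u t) (differentiableB dgt (differentiable_cst (g 0) t))).
pose P x y := Im (F (Complex x y)); pose Q x y := Re (F (Complex x y)).
have cf e x y : 0 < e -> `|x| <= r -> `|y| <= r -> e <= `|x| \/ e <= `|y| ->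
    closed_form_at P Q x y.
  move=> e0 xr yr exy; apply/has_cderiv_closed_form/differentiable_has_cderiv/dF => //.
  by apply/eqP => -[x0 y0]; move: exy; rewrite x0 y0 normr0; arith.
have M0 : 0 <= M by apply: le_trans (cabs_ge0 (g 0)) (gM _ _ _); rewrite normr0 ltW.
have cPs e y : 0 < e <= r -> `|y| = e -> cont_seg (P ^~ y) (- e) e.
  move=> /andP[e0 er] ye; apply: (@closed_form_contP _ P Q (- e) e y y y); last by rewrite lexx.
  move=> x y' /andP[h1 h2] /andP[h3 h4].
  have -> : y' = y by arith.
  by apply: (cf e) => //; [rewrite ler_norml; arith|rewrite ye|right; rewrite ye].
have cQs e x : 0 < e <= r -> `|x| = e -> cont_seg (Q x) (- e) e.
  move=> /andP[e0 er] xe; apply: (@closed_form_contQ _ P Q x x (- e) e x); last by rewrite lexx.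
  move=> x' y /andP[h1 h2] /andP[h3 h4].
  have -> : x' = x by arith.
  by apply: (cf e) => //; [rewrite xe|rewrite ler_norml; arith|left; rewrite xe].
have up : circulation P Q (- r) r (- r) r <= 16 * M / r.
  have rr : 0 < r <= r by rewrite r0 lexx.
  have nr : `|r| = r by rewrite gtr0_norm.
  have nNr : `|- r| = r by rewrite normrN.
  have FM (t : C) : `|Re t| <= r -> `|Im t| <= r -> r <= `|Re t| \/ r <= `|Im t| ->
      cabs (F t) <= 2 * M / r ^+ 2.
    move=> h1 h2 h3.
    have rt : r <= cabs t.
      by case: h3 => h3; apply: (le_trans h3); [exact: Re_cabs|exact: Im_cabs].
    have t0 : 0 < cabs t by arith.
    rewrite /F /w !cabsM !cabsV u1 mul1r -invfM -expr2.
    rewrite ler_pM ?invr_ge0 ?cabs_ge0//.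
    - by rewrite expr2 mulr_ge0 ?cabs_ge0.
    - apply: le_trans (cabsD _ _) _; rewrite cabsN.
      have := gM t h1 h2; have := gM 0; rewrite normr0 => /(_ (ltW r0) (ltW r0)); arith.
    - by rewrite lef_pV2 ?posrE ?exprn_gt0// ler_pXn2r// nnegrE ltW.
  have FP x y : `|x| <= r -> `|y| <= r -> r <= `|x| \/ r <= `|y| ->
      - (2 * M / r ^+ 2) <= P x y <= 2 * M / r ^+ 2
      /\ - (2 * M / r ^+ 2) <= Q x y <= 2 * M / r ^+ 2.
    move=> h1 h2 h3; have := FM (Complex x y) h1 h2 h3 => h4.
    by rewrite -!ler_norml; split; apply: le_trans h4; [exact: Im_cabs|exact: Re_cabs].
  have k1 := @segint_le _ (P ^~ (- r)) (- r) r (2 * M / r ^+ 2) ltac:(arith) (cPs r _ rr nNr).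
  have k2 := @segint_le _ (Q r) (- r) r (2 * M / r ^+ 2) ltac:(arith) (cQs r _ rr nr).
  have k3 := @segint_ge _ (P ^~ r) (- r) r (- (2 * M / r ^+ 2)) ltac:(arith) (cPs r _ rr nr).
  have k4 := @segint_ge _ (Q (- r)) (- r) r (- (2 * M / r ^+ 2)) ltac:(arith) (cQs r _ rr nNr).
  have inr x : - r <= x <= r -> `|x| <= r by rewrite ler_norml.
  have rle : r <= `|r| by rewrite nr.
  have Nrle : r <= `|- r| by rewrite nNr.
  have ler : `|r| <= r by rewrite nr.
  have leNr : `|- r| <= r by rewrite nNr.
  have {}k1 := k1 (fun x xr => (andP (FP x _ (inr _ xr) leNr (or_intror Nrle)).1).2).
  have {}k2 := k2 (fun x xr => (andP (FP _ x ler (inr _ xr) (or_introl rle)).2).2).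
  have {}k3 := k3 (fun x xr => (andP (FP x _ (inr _ xr) ler (or_intror rle)).1).1).
  have {}k4 := k4 (fun x xr => (andP (FP _ x leNr (inr _ xr) (or_introl Nrle)).2).1).
  have -> : 16 * M / r = 4 * (2 * M / r ^+ 2 * (r - - r)) by field; rewrite gt_eqF.
  by rewrite /circulation; move: k1 k2 k3 k4; segint_arith.
(* On a small square the error of the first-order expansion of g costs eta. *)
apply/ler_addgt0Pr => eta eta0.
have [dl dl0 Hd] := gD (eta / 2) ltac:(arith).
(* The corners of the square are then at distance less than dl from 0. *)
pose e := Num.min r (dl / 4).
have e0 : 0 < e by rewrite /e lt_min r0 divr_gt0.
have er : e <= r by rewrite /e ge_min lexx.
have edl : e <= dl / 4 by rewrite /e ge_min lexx orbT.
have near x y : `|x| <= e -> `|y| <= e -> `|x| = e \/ `|y| = e ->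
    [/\ x * (d / (x ^+ 2 + y ^+ 2)) - eta / 2 / e <= Q x y,
        Q x y <= x * (d / (x ^+ 2 + y ^+ 2)) + eta / 2 / e,
        - y * (d / (x ^+ 2 + y ^+ 2)) - eta / 2 / e <= P x y &
        P x y <= - y * (d / (x ^+ 2 + y ^+ 2)) + eta / 2 / e].
  move=> h1 h2 h3; pose t : C := Complex x y.
  have rt : e <= cabs t.
    by case: h3 => <-; [exact: (Re_cabs t)|exact: (Im_cabs t)].
  have t0 : 0 < cabs t by arith.
  have t00 : t != 0 by rewrite -cabs_eq0 gt_eqF.
  have tdl : cabs t < dl.
    by apply: (le_lt_trans (cabs_ReIm t)); rewrite /t/=; arith.
  have := Hd t tdl; rewrite add0r => Hw.
  have wE : cabs (w t - rc d * t) <= eta / 2 * cabs t.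
    rewrite (_ : _ - _ = u * (g t - g 0 - D * t)); last by rewrite /w -uD; ring.
    by rewrite cabsM u1 mul1r.
  have FE : cabs (F t - rc d * t^-1) <= eta / 2 / e.
    rewrite (_ : _ - _ = (w t - rc d * t) * (t^-1 * t^-1)); last first.
      by rewrite /F mulrBl -[rc d * t * _]mulrA [t * _]mulrA divff// mul1r.
    rewrite !cabsM cabsV.
    apply: (@le_trans _ _ (eta / 2 * cabs t * ((cabs t)^-1 * (cabs t)^-1))).
      by rewrite ler_wpM2r// mulr_ge0 ?invr_ge0 ?(ltW t0).
    have -> : eta / 2 * cabs t * ((cabs t)^-1 / cabs t) = eta / 2 / cabs t.
      by field; rewrite gt_eqF.
    rewrite ler_wpM2l//; first arith.
    by rewrite lef_pV2 ?posrE.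
  have := le_trans (Re_cabs _) FE; have := le_trans (Im_cabs _) FE.
  rewrite creD cimD creN cimN creM cimM creV cimV /= !mul0r subr0 addr0.
  have -> : Re (F t) = Q x y by [].
  have -> : Im (F t) = P x y by [].
  have -> : d * (x / (x ^+ 2 + y ^+ 2)) = x * (d / (x ^+ 2 + y ^+ 2)) by ring.
  have -> : d * (- y / (x ^+ 2 + y ^+ 2)) = - y * (d / (x ^+ 2 + y ^+ 2)) by ring.
  by rewrite !ler_norml; clear => /andP[? ?] /andP[? ?]; split; arith.
have ee : 0 < e <= r by rewrite e0 er.
have ne : `|e| = e by rewrite gtr0_norm.
have nNe : `|- e| = e by rewrite normrN.
have dbd x y : `|x| <= e -> `|y| <= e -> `|x| = e \/ `|y| = e ->
    d / (2 * e ^+ 2) <= d / (x ^+ 2 + y ^+ 2).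
  move=> h1 h2 h3.
  have x2 : x ^+ 2 <= e ^+ 2 by rewrite -ler_sqrt ?sqr_ge0// !sqrtr_sqr [`|e|]gtr0_norm.
  have y2 : y ^+ 2 <= e ^+ 2 by rewrite -ler_sqrt ?sqr_ge0// !sqrtr_sqr [`|e|]gtr0_norm.
  have e2 : 0 < e ^+ 2 by rewrite exprn_gt0.
  have xy2 : e ^+ 2 <= x ^+ 2 + y ^+ 2.
    have := sqr_ge0 x; have := sqr_ge0 y.
    by case: h3 => <-; rewrite (real_normK (num_real _)); arith.
  by rewrite ler_pM2l// lef_pV2 ?posrE; arith.
have k1 := @segint_ge _ (P ^~ (- e)) (- e) e (d / (2 * e) - eta / 2 / e) ltac:(arith) (cPs e _ ee nNe).
have k2 := @segint_ge _ (Q e) (- e) e (d / (2 * e) - eta / 2 / e) ltac:(arith) (cQs e _ ee ne).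
have k3 := @segint_le _ (P ^~ e) (- e) e (- (d / (2 * e) - eta / 2 / e)) ltac:(arith) (cPs e _ ee ne).
have k4 := @segint_le _ (Q (- e)) (- e) e (- (d / (2 * e) - eta / 2 / e)) ltac:(arith) (cQs e _ ee nNe).
have E1 : d / (2 * e) = e * (d / (2 * e ^+ 2)) by field; rewrite gt_eqF.
have b1 x y : `|x| <= e -> `|y| <= e -> `|x| = e \/ `|y| = e ->
    d / (2 * e) <= e * (d / (x ^+ 2 + y ^+ 2)).
  by move=> h1 h2 h3; rewrite E1 ler_pM2l//; exact: dbd.
have ine x : - e <= x <= e -> `|x| <= e by rewrite ler_norml.
have lee : `|e| <= e by rewrite ne.
have leNe : `|- e| <= e by rewrite nNe.
have {}k1 : (d / (2 * e) - eta / 2 / e) * (e - - e) <= segint (P ^~ (- e)) (- e) e.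
  apply: k1 => x /ine xe; have [_ _ h _] := near x (- e) xe leNe (or_intror nNe).
  by move: h; rewrite opprK; have := b1 x (- e) xe leNe (or_intror nNe); arith.
have {}k2 : (d / (2 * e) - eta / 2 / e) * (e - - e) <= segint (Q e) (- e) e.
  apply: k2 => x /ine xe; have [h _ _ _] := near e x lee xe (or_introl ne).
  by move: h; have := b1 e x lee xe (or_introl ne); arith.
have {}k3 : segint (P ^~ e) (- e) e <= - (d / (2 * e) - eta / 2 / e) * (e - - e).
  apply: k3 => x /ine xe; have [_ _ _ h] := near x e xe lee (or_intror ne).
  by move: h; have := b1 x e xe lee (or_intror ne); arith.
have {}k4 : segint (Q (- e)) (- e) e <= - (d / (2 * e) - eta / 2 / e) * (e - - e).
  apply: k4 => x /ine xe; have [_ h _ _] := near (- e) x leNe xe (or_introl nNe).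
  by move: h; have := b1 (- e) x leNe xe (or_introl nNe); arith.
have low : 4 * d - 4 * eta <= circulation P Q (- e) e (- e) e.
  have E2 : (d / (2 * e) - eta / 2 / e) * (e - - e) = d - eta.
    by field; rewrite gt_eqF.
  by rewrite /circulation; move: k1 k2 k3 k4; rewrite !mulNr E2; segint_arith.
have FR := @circulation_frame P Q e r e0 er (fun x y h1 h2 h3 => cf e x y e0 h1 h2 h3).
move: up low; rewrite FR (_ : 16 * M / r = 4 * (4 * M / r)); last by ring.
by clear; move: (circulation _ _ _ _ _ _) (4 * M / r) => N L; lra.
Qed.

End cauchy_derivative.

(** * Cauchy estimates on complex lines *)

Section cauchy_several_variables.
Variable R : realType.
Local Notation C := (Cplx R).
Local Notation Re := (@complex.Re R).
Local Notation Im := (@complex.Im R).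
Variable V : normedModType C.
Implicit Types (f : V -> C) (a v : V) (r M : R).

Definition holo_bounded f a r M := forall w, rnorm (w - a) <= r ->
  differentiable f w /\ cabs (f w) <= M.

(** Cauchy's estimate for t |-> f (a + t v): the square of half-side
r / (2 |v|) lies in the disc of radius r / |v|. *)
Lemma cauchy_gradient f a v r M : 0 < r -> holo_bounded f a r M ->
  cabs ('d f a v) <= 8 * M * rnorm v / r.
Proof.
move=> r0 Hf.
have [->|v0] := eqVneq v 0.
  by rewrite linear0 cabs0 rnorm0 mulr0 mul0r.
have nv0 : 0 < rnorm v.
  by rewrite lt_def rnorm_ge0 andbT; apply: contra_neq v0; exact: rnorm_eq0.
have rho0 : 0 < r / (2 * rnorm v) by rewrite divr_gt0// mulr_gt0.
have sq (t : C) : `|Re t| <= r / (2 * rnorm v) -> `|Im t| <= r / (2 * rnorm v) ->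
    rnorm (a + t *: v - a) <= r.
  move=> h1 h2; rewrite addrC addKr rnormZ -ler_pdivlMr//.
  apply: (le_trans (cabs_ReIm t)).
  have -> : r / rnorm v = r / (2 * rnorm v) + r / (2 * rnorm v).
    by field; rewrite gt_eqF.
  exact: lerD.
have a0 : rnorm (a + 0 *: v - a) <= r by apply: sq; rewrite normr0 ltW.
have aE : a + (0 : C) *: v = a by rewrite scale0r addr0.
have := @cauchy_derivative _ (fun s : C => f (a + s *: v)) (r / (2 * rnorm v)) M
  ('d f a v) rho0.
have -> : 4 * M / (r / (2 * rnorm v)) = 8 * M * rnorm v / r.
  by field; rewrite !gt_eqF.
apply.
- have slice0 b : b = a + (0 : C) *: v -> differentiable f b ->
      has_cderiv (fun s : C => f (a + s *: v)) 0 ('d f b v).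
    by move=> ->; exact: has_cderiv_slice.
  apply: slice0; first by rewrite aE.
  have a1 : rnorm (a - a) <= r by rewrite subrr rnorm0 ltW.
  by have [] := Hf a a1.
- move=> t h1 h2; have [df _] := Hf _ (sq t h1 h2).
  exact: has_cderiv_differentiable (has_cderiv_slice df).
- by move=> t h1 h2; have [] := Hf _ (sq t h1 h2).
Qed.

Lemma has_cderiv_is_derive (g : C -> C) (s : R) D :
  has_cderiv g (rc s) D -> is_derive s (1 : R) (fun x : R => Re (g (rc x))) (Re D).
Proof.
move=> H.
suff cv : (h^-1 *: (((fun x : R => Re (g (rc x))) \o shift s) (h *: (1 : R)) -
    Re (g (rc s)))) @[h --> 0^'] --> Re D.
  by apply: DeriveDef; [apply: cvgP cv|apply: cvg_lim cv].
apply/cvgrPdist_le => e e0; have [d d0 Hd] := H e e0.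
near=> h.
have h0 : h != 0 by near: h; exact: nbhs_dnbhs_neq.
have hd : cabs (rc h) < d.
  rewrite cabs_rc; near: h; apply: dnbhs0_lt => //.
have := le_trans (Re_cabs _) (Hd _ hd).
rewrite creD creN creM /= mulr0 subr0 -rcD creD creN cabs_rc addrC [s + h]addrC => H1.
rewrite /= /shift /= [h *: 1]mulr1 -[_ *: _]/(h^-1 * _).
have -> : Re D - h^-1 * (Re (g (rc (h + s))) - Re (g (rc s))) =
  - (h^-1 * ((Re (g (rc (h + s))) - Re (g (rc s)) - Re D * h))).
  by field.
rewrite normrN normrM normfV ler_pdivrMl ?normr_gt0// mulrC.
by rewrite [leRHS]mulrC [h * _]mulrC [_ - _ * h]addrC; exact: H1.
Unshelve. all: by end_near. Qed.

(** The mean value theorem for the real part of u f along the segment, the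
unimodular u being chosen so that u (f (a + v) - f a) is a positive real; each
point of the segment is the centre of a ball of radius r / 2 on which
cauchy_gradient applies. *)
Lemma cauchy_lipschitz f a v r M : 0 < r -> holo_bounded f a r M ->
  rnorm v <= r / 2 -> cabs (f (a + v) - f a) <= 16 * M * rnorm v / r.
Proof.
move=> r0 Hf vr.
have M0 : 0 <= M.
  have [_] := Hf a ltac:(rewrite subrr rnorm0 ltW//).
  exact: le_trans (cabs_ge0 _).
set E := f (a + v) - f a.
have [E0|E0] := eqVneq E 0.
  by rewrite E0 cabs0 divr_ge0 ?(ltW r0)// mulr_ge0 ?rnorm_ge0// mulr_ge0.
have cE0 : cabs E != 0 by rewrite cabs_eq0.
have [u uE u1] : exists2 u : C, u * E = rc (cabs E) & cabs u = 1.
  exists (rc (cabs E) / E); first by rewrite divfK.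
  by rewrite cabsM cabsV cabs_rc (ger0_norm (cabs_ge0 _)) divff.
have onseg (s : R) : 0 <= s <= 1 -> rnorm (a + rc s *: v - a) <= r / 2.
  move=> /andP[s0 s1]; rewrite addrC addKr rnormZ cabs_rc ger0_norm//.
  by apply: le_trans vr; rewrite ler_piMl ?rnorm_ge0.
have inball (s : R) w : 0 <= s <= 1 -> rnorm (w - (a + rc s *: v)) <= r / 2 ->
    rnorm (w - a) <= r.
  move=> /onseg h1 h2; rewrite -(subrK (a + rc s *: v) w) -addrA.
  by apply: le_trans (rnormD _ _) _; arith.
pose g (s : C) := u * f (a + s *: v).
have gd (s : R) : 0 <= s <= 1 -> has_cderiv g (rc s) (u * 'd f (a + rc s *: v) v).
  have rr : r / 2 <= r by arith.
  move=> s01 e e0.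
  have [df _] := Hf _ (le_trans (onseg s s01) rr).
  have [d d0 Hd] := has_cderiv_slice df e0; exists d => // h hd.
  rewrite /g; set x := f _; set y := f _; set D := 'd f _ v.
  have -> : u * x - u * y - u * D * h = u * (x - y - D * h) by ring.
  by rewrite cabsM u1 mul1r; exact: Hd.
pose phi (s : R) := Re (g (rc s)).
have dphi (s : R) : 0 <= s <= 1 ->
    is_derive s (1 : R) phi (Re (u * 'd f (a + rc s *: v) v)).
  by move=> s01; apply: has_cderiv_is_derive; exact: gd.
have [||c cin] := @MVT_segment R phi (fun s => Re (u * 'd f (a + rc s *: v) v)) 0 1 ler01.
- by move=> x; rewrite in_itv/= => /andP[x0 x1]; apply: dphi; rewrite !ltW.
- apply: continuous_in_subspaceT => x; rewrite inE/= in_itv/= => x01.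
  have dx := dphi x x01.
  by apply/differentiable_continuous/derivable1_diffP; exact: ex_derive.
have -> : phi 1 - phi 0 = cabs E.
  rewrite /phi /g rc0 rc1 scale1r scale0r addr0.
  by rewrite -[LHS]/(Re (u * f (a + v)) + - Re (u * f a)) -creN -creD -mulrBr uE.
rewrite subr0 mulr1 => ->.
move: cin; rewrite in_itv/= => cin.
apply: le_trans (ler_norm _) _; apply: le_trans (Re_cabs _) _.
rewrite cabsM u1 mul1r.
have := @cauchy_gradient f (a + rc c *: v) v (r / 2) M ltac:(arith).
have -> : 8 * M * rnorm v / (r / 2) = 16 * M * rnorm v / r by field; rewrite gt_eqF.
apply => w wr; apply: Hf; exact: inball wr.
Qed.

End cauchy_several_variables.

(** * Open sets of C^n are measurable *)

Section row_vector_norm.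
Variables (R : realType) (n : nat).
Local Notation V := (Cvec R n).
Implicit Types (v : V) (d : R).

Lemma cabs_coord v j : cabs (v 0 j) <= rnorm v.
Proof.
rewrite -rc_le -cabsE -rnormE -[`|v|]/(mx_norm v) /mx_norm.
rewrite -[leLHS]nngE num_le.
by have := @le_bigmax _ _ _ 0%:nng (fun i : 'I_1 * 'I_n => `|v i.1 i.2|%:nng) (0, j).
Qed.

Lemma rnorm_lt v d : 0 < d -> (forall j, cabs (v 0 j) < d) -> rnorm v < d.
Proof.
move=> d0 H; have [v0|v0] := eqVneq (rnorm v) 0; first by rewrite v0.
have : mx_norm v != 0.
  by apply: contra_neq v0 => v0; rewrite /rnorm -[`|v|]/(mx_norm v) v0.
move=> /mx_norm_neq0[[i j] /= vE].
by rewrite /rnorm -[`|v|]/(mx_norm v) vE ord1; exact: H.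
Qed.

Lemma rnorm_le v d : 0 <= d -> (forall j, cabs (v 0 j) <= d) -> rnorm v <= d.
Proof.
move=> d0 H; have [v0|v0] := eqVneq (rnorm v) 0; first by rewrite v0.
have : mx_norm v != 0.
  by apply: contra_neq v0 => v0; rewrite /rnorm -[`|v|]/(mx_norm v) v0.
move=> /mx_norm_neq0[[i j] /= vE].
by rewrite /rnorm -[`|v|]/(mx_norm v) vE ord1; exact: H.
Qed.

End row_vector_norm.

Section measurable_open.
Variables (R : realType) (n : nat).
Local Notation V := (Cvec R n).
Local Notation T := ((n + n).-tuple (measurableTypeR R)).

(** Boxes with rational corners: countably many, so that an open set is a countable
union of those it contains. *)
Definition rbox (b : (n + n).-tuple (rat * rat)) : set T :=
  [set u : T | forall i, ratr (tnth b i).1 < tnth u i < ratr (tnth b i).2].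

Lemma measurable_rbox b : measurable (rbox b).
Proof.
rewrite (_ : rbox b = \bigcap_(i in [set: 'I_(n + n)])
    ((fun u : T => tnth u i) @^-1` `]ratr (tnth b i).1, ratr (tnth b i).2[)).
  apply: fin_bigcap_measurable => // i _.
  by rewrite -[X in measurable X]setTI; apply: measurable_tnth.
apply/seteqP; split=> [u ub i _ /=|u ub i]; first by rewrite in_itv/=; exact: ub.
by have := ub i I; rewrite /= in_itv.
Qed.

Lemma cvec_close (u w : T) (d : R) : 0 < d ->
  (forall i, `|tnth w i - tnth u i| < d / 2) -> rnorm (cvec w - cvec u) < d.
Proof.
move=> d0 H; apply: rnorm_lt => // j; rewrite !mxE.
apply: (le_lt_trans (cabs_ReIm _)); rewrite creD cimD creN cimN /=.
by rewrite [d]splitr; apply: ltrD; exact: H.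
Qed.

Lemma open_measurable_Cvec (U : set V) : open U -> measurable U.
Proof.
move=> oU; rewrite -[measurable U]/(measurable (@cvec R n @^-1` U)).
pose F k := if unpickle k is Some b then
  if `[< rbox b `<=` @cvec R n @^-1` U >] then rbox b else set0 else set0.
suff -> : @cvec R n @^-1` U = \bigcup_k F k.
  apply: bigcupT_measurable => k; rewrite /F; case: unpickle => // b.
  by case: asboolP => // _; exact: measurable_rbox.
apply/seteqP; split => [u Uu|u [k _]]; last first.
  by rewrite /F; case: unpickle => // b; case: asboolP => // sub; exact: sub.
have [d d0 Hd] := open_rnormP oU Uu.
have ex i : exists p : rat * rat, [/\ tnth u i - d / 2 < ratr p.1, ratr p.1 < tnth u i,
    tnth u i < ratr p.2 & ratr p.2 < tnth u i + d / 2].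
  have [|q /[!in_itv]/= /andP[q1 q2]] := @rat_in_itvoo R (tnth u i - d / 2) (tnth u i); first arith.
  have [|p /[!in_itv]/= /andP[p1 p2]] := @rat_in_itvoo R (tnth u i) (tnth u i + d / 2); first arith.
  by exists (q, p).
have [p Hp] := choice ex.
pose b : (n + n).-tuple (rat * rat) := [tuple p i | i < n + n].
exists (pickle b) => //; rewrite /F pickleK.
have bu : rbox b u by move=> i; rewrite tnth_mktuple; have [_ -> ->] := Hp i.
case: asboolP => // nsub; exfalso; apply: nsub => w wb /=.
apply: Hd; apply: cvec_close => // i.
have := wb i; rewrite tnth_mktuple => /andP[w1 w2].
by have [h1 h2 h3 h4] := Hp i; rewrite ltr_norml; apply/andP; split; arith.
Qed.

Lemma continuous_measurable (U : set V) (f : V -> R) : open U ->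
  {in U, continuous f} -> measurable_fun U f.
Proof.
move=> oU cf; apply: (measurability (@RGenOpens.G R)).
  exact: RGenOpens.measurableE.
move=> _ [_ [a [b ->]] <-]; apply: open_measurable_Cvec.
rewrite openE => v [Uv fv] /=; rewrite /interior.
apply: filterI; first exact: open_nbhs_nbhs.
have /cf cv : v \in U by rewrite inE.
by apply: cv; apply: open_nbhs_nbhs; split => //; exact: interval_open.
Qed.

End measurable_open.

(** * Volume of balls *)

Section cube_volume.
Variable R : realType.
Local Notation leb := (@lebesgue_measure R).

Definition cube m (c : m.-tuple (measurableTypeR R)) (s : R) :
    set (m.-tuple (measurableTypeR R)) :=
  [set u | forall i, tnth c i <= tnth u i <= tnth c i + s].

Lemma measurable_cube m (c : m.-tuple (measurableTypeR R)) s :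
  measurable (cube c s).
Proof.
rewrite (_ : cube c s = \bigcap_(i in [set: 'I_m])
    ((fun u : m.-tuple (measurableTypeR R) => tnth u i) @^-1`
      `[tnth c i, tnth c i + s])).
  apply: fin_bigcap_measurable => // i _.
  by rewrite -[X in measurable X]setTI; apply: measurable_tnth.
apply/seteqP; split=> [u ub i _ /=|u ub i]; first by rewrite in_itv/=; exact: ub.
by have := ub i I; rewrite /= in_itv.
Qed.

Lemma volume_cube m (c : m.-tuple (measurableTypeR R)) (s : R) : 0 <= s ->
  tuple_measure leb m (cube c s) = (s ^+ m)%:E.
Proof.
move=> s0; elim: m c => [|m IH] c.
  rewrite /= diracE expr0 (_ : _ \in _ = true)//.
  by apply/mem_set => -[].
rewrite -[LHS]/((leb \x tuple_measure leb m)%E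
    (@tuple_cons _ (measurableTypeR R) m @^-1` cube c s)).
rewrite (_ : _ @^-1` _ = `[thead c, thead c + s]%classic `*` cube [tuple of behead c] s).
  rewrite product_measure1E//; last exact: measurable_cube.
  rewrite IH exprS EFinM; congr (_ * _)%E.
  have cs : (thead c : R) <= (thead c : R) + s by rewrite lerDl.
  by rewrite [LHS](lebesgue_segment cs) addrAC subrr add0r.
apply/seteqP; split => -[x u] /=.
  move=> H; split.
    by have := H ord0; rewrite in_itv/= /thead !(tnth_nth x).
  move=> i; have := H (lift ord0 i).
  by rewrite !(tnth_nth x) /= nth_behead.
rewrite in_itv/= => -[H1 H2] i.
case: (unliftP ord0 i) => [j|] ->.
  by have := H2 j; rewrite !(tnth_nth x) /= nth_behead.
by move: H1; rewrite /thead !(tnth_nth x).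
Qed.

Variable n : nat.
Local Notation V := (Cvec R n).

Definition rball (a : V) (d : R) : set V := [set w | rnorm (w - a) < d].

Lemma open_rball a d : open (rball a d).
Proof.
rewrite openE => w wd; apply/nbhs_rnormP; exists (d - rnorm (w - a)).
  by rewrite subr_gt0.
move=> w' h; rewrite /rball/= -(subrK w w') -addrA.
by apply: le_lt_trans (rnormD _ _) _; arith.
Qed.

(** The ball contains the cube of side d / 2 with the same centre, since both
coordinates of each component are then at most d / 4 in modulus. *)
Lemma volume_rball (a : V) (d : R) : 0 < d ->
  (((d / 2) ^+ (n + n))%:E <= lebesgue_Cn (rball a d))%E.
Proof.
move=> d0.
pose c : (n + n).-tuple (measurableTypeR R) :=
  [tuple (match fintype.split i with inl j => complex.Re (a 0 j) : R
                           | inr j => complex.Im (a 0 j) : R end) - d / 4 | i < n + n].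
rewrite -(volume_cube c); last arith.
rewrite /lebesgue_Cn /pushforward; apply: le_measure; rewrite ?inE.
- exact: measurable_cube.
- by have mB := open_measurable_Cvec (@open_rball a d); exact: mB.
move=> u uc; rewrite /rball/=; apply: rnorm_lt => // j.
rewrite !mxE; apply: le_lt_trans (cabs_ReIm _) _.
rewrite creD cimD creN cimN/=.
have := uc (lshift n j); have := uc (rshift n j).
rewrite !tnth_mktuple (unsplitK (inl j)) (unsplitK (inr j)).
move=> /andP[h1 h2] /andP[h3 h4].
set x : R := tnth u (lshift n j) in h3 h4 *; set y : R := tnth u (rshift n j) in h1 h2 *.
have hx : `|x - complex.Re (a 0 j)| <= d / 4 by rewrite ler_norml; arith.
have hy : `|y - complex.Im (a 0 j)| <= d / 4 by rewrite ler_norml; arith.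
by apply: le_lt_trans (lerD hx hy) _; arith.
Qed.

End cube_volume.

(** * Mean square bounds on point values *)

Section compact_polydisc.
Variables (R : realType) (n : nat).
Local Notation C := (Cplx R).
Local Notation V := (Cvec R n).

(** Squares, being products of real segments, are compact; balls of C^n are replaced
by polysquares where compactness matters. *)
Definition square (x : C) (r : R) : set C := [set y |
  `|complex.Re (y - x)| <= r /\ `|complex.Im (y - x)| <= r].

Lemma compact_square (x : C) r : compact (square x r).
Proof.
pose mk (p : R * R) : C := x + Complex p.1 p.2.
have -> : square x r = mk @` (`[- r, r] `*` `[- r, r]).
  apply/seteqP; split => [y [h1 h2]|_ [[u v] [/= h1 h2] <-]].
    exists (complex.Re (y - x) : R, complex.Im (y - x) : R).
      by split; rewrite /= in_itv/= -ler_norml.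
    rewrite /mk -[RHS](subrK x) [RHS]addrC; congr (_ + _).
    exact: complex_ext.
  move: h1 h2; rewrite !in_itv/= -!ler_norml => h1 h2.
  by rewrite /square/= /mk addrC addKr.
apply: continuous_compact; last by apply: compact_setX; exact: segment_compact.
apply: continuous_subspaceT => -[u v]; apply/cvg_cabsP => e e0.
have e20 : 0 < e / 2 by arith.
near=> p.
rewrite /mk opprD addrACA subrr add0r.
apply: le_lt_trans (cabs_ReIm _) _.
rewrite creD cimD creN cimN/= [e]splitr; apply: ltrD.
- by rewrite distrC; near: p; move: (e / 2) e20; apply/cvgrPdist_lt; exact: cvg_fst.
- by rewrite distrC; near: p; move: (e / 2) e20; apply/cvgrPdist_lt; exact: cvg_snd.
Unshelve. all: by end_near. Qed.

Definition polysquare (a : V) (r : R) : set V :=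
  [set w | forall j, square (a 0 j) r (w 0 j)].

Lemma compact_polysquare a r : compact (polysquare a r).
Proof. by apply: (@rV_compact C n (fun j => square (a 0 j) r)) => j; exact: compact_square. Qed.

Lemma polysquare_rnorm a r w : 0 <= r -> polysquare a r w -> rnorm (w - a) <= 2 * r.
Proof.
move=> r0 H; apply: rnorm_le => [|j]; first arith.
have [h1 h2] := H j; rewrite !mxE; apply: le_trans (cabs_ReIm _) _; arith.
Qed.

Lemma rnorm_polysquare a r w : rnorm (w - a) <= r -> polysquare a r w.
Proof.
move=> H j; have := le_trans (cabs_coord (w - a) j) H; rewrite !mxE => h.
by split; [apply: le_trans (Re_cabs _) h|apply: le_trans (Im_cabs _) h].
Qed.

End compact_polydisc.

Section L2_evaluation.
Variables (R : realType) (n : nat).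
Local Notation C := (Cplx R).
Local Notation V := (Cvec R n).

Lemma cabs_dist (x y : C) : `|cabs x - cabs y| <= cabs (x - y).
Proof.
have h1 := cabsD (x - y) y; have h2 := cabsD (y - x) x.
move: h1 h2; rewrite !subrK (cabsB y x) ler_norml; arith.
Qed.

Lemma rnorm_dist (W : normedModType C) (x y : W) : `|rnorm x - rnorm y| <= rnorm (x - y).
Proof.
have h1 := rnormD (x - y) y; have h2 := rnormD (y - x) x.
move: h1 h2; rewrite !subrK (rnormB y x) ler_norml; arith.
Qed.

Lemma continuous_realP (W : normedModType C) (f : W -> R) v :
  (forall e : R, 0 < e ->
    exists2 d : R, 0 < d & forall w, rnorm (w - v) < d -> `|f w - f v| < e) ->
  {for v, continuous f}.
Proof.
move=> H; apply/cvgrPdist_lt => e e0; apply/nbhs_rnormP.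
by have [d d0 Hd] := H e e0; exists d => // w /Hd; rewrite distrC.
Qed.

Lemma continuous_cabs (W : normedModType C) (f : W -> C) v :
  {for v, continuous f} -> {for v, continuous (fun w => cabs (f w))}.
Proof.
move=> /continuous_cabsP H; apply: continuous_realP => e e0.
have [d d0 Hd] := H e e0; exists d => // w /Hd wd.
exact: le_lt_trans (cabs_dist _ _) wd.
Qed.

Lemma continuous_cabs_sqr (W : normedModType C) (f : W -> C) w :
  differentiable f w -> {for w, continuous (fun w => cabs (f w) ^+ 2)}.
Proof.
move=> df; apply: (@continuous_comp _ _ _ (fun w => cabs (f w)) (fun x : R => x ^+ 2)).
  by apply: continuous_cabs; exact: differentiable_continuous.
exact: exprn_continuous.
Qed.

Lemma continuous_rnormB (W : normedModType C) (a v : W) :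
  {for v, continuous (fun w : W => rnorm (w - a))}.
Proof.
apply: continuous_realP => e e0; exists e => // w wd.
apply: le_lt_trans (rnorm_dist _ _) _.
by rewrite opprB addrA subrK.
Qed.

Lemma continuous_weight (W : normedModType C) (f : W -> C) (a w : W) (r : R) m :
  differentiable f w ->
  {for w, continuous (fun w => cabs (f w) * Num.max 0 (r - rnorm (w - a)) ^+ m)}.
Proof.
move=> df; apply: cvgM.
  by apply: continuous_cabs; exact: differentiable_continuous.
apply: (@continuous_comp _ _ _ (fun w => Num.max 0 (r - rnorm (w - a)))
  (fun x : R => x ^+ m)); last exact: exprn_continuous.
apply: continuous_max; first exact: cvg_cst.
by apply: cvgB; [exact: cvg_cst|exact: continuous_rnormB].
Qed.

(** The point c maximizes |f w| d(w)^(n+1) with d(w) = r - |w - a|.  On the ball of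
radius d / 2 around c the weight has decreased by a factor 2^(n+1) at most, so
|f| <= 2^(n+1) |f c| there, and cauchy_lipschitz keeps |f| close to |f c| on a
smaller ball.  The exponent n + 1 rather than n makes the weight vanish on the
boundary even when n = 0; the extra factor is dropped using d <= r. *)
Lemma weighted_maximum (f : V -> C) (a : V) (r : R) : 0 < r ->
  (forall w, rnorm (w - a) <= 2 * r -> differentiable f w) -> f a != 0 ->
  exists c d, [/\ 0 < d, d <= r, rnorm (c - a) <= r - d,
    cabs (f a) * r ^+ n <= cabs (f c) * d ^+ n &
    forall w, rnorm (w - c) < d / (64 * 2 ^+ n.+1) -> cabs (f c) / 2 <= cabs (f w)].
Proof.
move=> r0 df fa0.
pose dst (w : V) : R := Num.max 0 (r - rnorm (w - a)).
pose phi (w : V) : R := cabs (f w) * dst w ^+ n.+1.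
have ra : dst a = r by rewrite /dst subrr rnorm0 subr0 max_r// ltW.
have [||c cA cmax] := @compact_EVT_max V R phi (polysquare a r) _ (@compact_polysquare _ _ a r).
- by exists a; apply: rnorm_polysquare; rewrite subrr rnorm0 ltW.
- apply: continuous_in_subspaceT => w; rewrite inE => /(polysquare_rnorm (ltW r0)) wr.
  exact/continuous_weight/df.
have phia : cabs (f a) * r ^+ n.+1 <= phi c.
  have := cmax a; rewrite /phi ra; apply; rewrite inE.
  by apply: rnorm_polysquare; rewrite subrr rnorm0 ltW.
have fa0' : 0 < cabs (f a) by rewrite lt_def cabs_eq0 fa0 cabs_ge0.
have phic0 : 0 < phi c by apply: lt_le_trans phia; rewrite mulr_gt0// exprn_gt0.
have dstc : 0 < dst c.
  rewrite lt_def /dst le_max lexx andbT; apply/eqP => d0.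
  by move: phic0; rewrite /phi /dst d0 expr0n mulr0 ltxx.
pose d := r - rnorm (c - a).
have dE : dst c = d.
  by move: dstc; rewrite /dst -/d; case: (leP 0 d) => // _; rewrite ltxx.
have d0 : 0 < d by rewrite -dE.
have dr : d <= r by rewrite /d gerBl rnorm_ge0.
exists c, d; split => //; first by rewrite /d; arith.
  move: phia; rewrite /phi dE !exprS => H.
  rewrite -(ler_pM2l r0) mulrCA (le_trans H)// mulrCA.
  by rewrite ler_wpM2r ?mulr_ge0 ?cabs_ge0 ?exprn_ge0 ?(ltW d0).
set M := 2 ^+ n.+1 * cabs (f c).
have hb : holo_bounded f c (d / 2) M.
  move=> w wc.
  have wa : rnorm (w - a) <= r - d / 2.
    rewrite -(subrK c w) -addrA; apply: le_trans (rnormD _ _) _.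
    by move: wc; rewrite /d; arith.
  have war : rnorm (w - a) <= r by arith.
  split; first by apply: df; arith.
  have := cmax w; rewrite inE => /(_ (rnorm_polysquare war)); rewrite /phi dE => H.
  have dw : d / 2 <= dst w by rewrite /dst le_max; apply/orP; right; arith.
  have d2n : 0 < (d / 2) ^+ n.+1 by rewrite exprn_gt0// divr_gt0.
  have d20 : 0 <= d / 2 by rewrite divr_ge0 // ltW.
  have dst0 : 0 <= dst w by rewrite /dst le_max lexx.
  have ME : M * (d / 2) ^+ n.+1 = cabs (f c) * d ^+ n.+1.
    by rewrite /M mulrAC -exprMn [2 * _]mulrC divfK// mulrC.
  rewrite -(ler_pM2r d2n) ME; apply: le_trans H.
  by apply: ler_wpM2l; [exact: cabs_ge0|apply: lerXn2r dw].
move=> w wc; pose K : R := 2 ^+ n.+1.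
have K1 : 1 <= K by rewrite /K exprn_ege1// ler1n.
have K0 : 0 < K by arith.
have vd : rnorm (w - c) <= d / 2 / 2.
  apply: ltW (lt_le_trans wc _); rewrite -/K ler_pdivrMr ?mulr_gt0//; nra.
have := cauchy_lipschitz (divr_gt0 d0 (ltr0n R 2)) hb vd.
rewrite [c + _]addrC subrK => lip.
have : cabs (f w - f c) <= cabs (f c) / 2.
  apply: (le_trans lip); rewrite ler_pdivrMr ?divr_gt0// /M -/K.
  move: wc; rewrite ltr_pdivlMr ?mulr_gt0// -/K => wc.
  by have := ler_wpM2l (cabs_ge0 (f c)) (ltW wc); arith.
have := cabsD (f w) (f c - f w); rewrite addrC subrK cabsB; arith.
Qed.

(** The integral over the ball of weighted_maximum is at least the square of
|f c| / 2 times its volume, which is a constant times d^(2 n). *)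
Lemma L2_point_evaluation (r : R) : 0 < r -> exists2 K : R, 0 < K &
  forall (f : V -> C) (Omega : set V) (a : V), open Omega -> holomorphic Omega f ->
  (forall w, rnorm (w - a) <= 2 * r -> Omega w) ->
  ((K * cabs (f a) ^+ 2)%:E <=
    \int[lebesgue_Cn]_(w in Omega) (cabs (f w) ^+ 2)%:E)%E.
Proof.
move=> r0; pose k : R := (r / (128 * 2 ^+ n.+1)) ^+ (n + n) / 4.
have k0 : 0 < k by rewrite divr_gt0// exprn_gt0// divr_gt0// mulr_gt0// exprn_gt0.
exists k => // f Omega a oO hf aO.
have [->|fa0] := eqVneq (f a) 0.
  by rewrite cabs0 expr0n/= mulr0; apply: integral_ge0 => w _; rewrite lee_fin sqr_ge0.
have [||c [d [d0 dr ca fad cd]]] := @weighted_maximum f a r r0 => //.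
  by move=> w /aO Ow; exact: hf.
pose B := rball c (d / (64 * 2 ^+ n.+1)).
have den0 : 0 < 64 * 2 ^+ n.+1 :> R by rewrite mulr_gt0// exprn_gt0.
have rad0 : 0 < d / (64 * 2 ^+ n.+1) by rewrite divr_gt0.
have mB := @open_measurable_Cvec R n B (@open_rball R n c _).
have mO := @open_measurable_Cvec R n _ oO.
have BO : B `<=` Omega.
  move=> w; rewrite /B /rball/= => wc; apply: aO.
  rewrite -(subrK c w) -addrA; apply: le_trans (rnormD _ _) _.
  have : d / (64 * 2 ^+ n.+1) <= d.
    rewrite ler_pdivrMr// ler_peMr ?(ltW d0)//.
    have : 1 <= 2 ^+ n.+1 :> R by rewrite exprn_ege1// ler1n.
    arith.
  arith.
have mf : measurable_fun Omega (fun w => (cabs (f w) ^+ 2)%:E).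
  apply/measurable_EFinP; apply: (@continuous_measurable R n Omega _ oO) => w.
  by rewrite inE => Ow; apply: continuous_cabs_sqr; exact: hf.
apply: le_trans; last first.
  by apply: (ge0_subset_integral _ mB mO mf _ BO) => w _; rewrite lee_fin sqr_ge0.
apply: (@le_trans _ _ (\int[lebesgue_Cn]_(w in B) ((cabs (f c) / 2) ^+ 2)%:E)%E); last first.
  apply: ge0_le_integral => //.
  - by move=> w _; rewrite lee_fin sqr_ge0.
  - exact: measurable_funS mf.
  - move=> w Bw; rewrite lee_fin; apply: lerXn2r; rewrite ?nnegrE ?divr_ge0 ?cabs_ge0//.
    exact: cd.
rewrite integral_cst//.
apply: le_trans; last first.
  by apply: lee_wpmul2l (volume_rball _ _) => //; rewrite lee_fin sqr_ge0.
rewrite -EFinM lee_fin /k.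
have -> : d / (64 * 2 ^+ n.+1) / 2 = d / (128 * 2 ^+ n.+1) by field; rewrite expf_neq0.
set D : R := 128 * 2 ^+ n.+1.
have D0 : D ^+ n != 0 by rewrite expf_neq0// mulf_neq0// expf_neq0.
have sq : (cabs (f a) * r ^+ n) ^+ 2 <= (cabs (f c) * d ^+ n) ^+ 2.
  by apply: lerXn2r fad; rewrite nnegrE mulr_ge0 ?cabs_ge0 ?exprn_ge0 ?(ltW r0) ?(ltW d0).
have -> : (r / D) ^+ (n + n) / 4 * cabs (f a) ^+ 2 =
    (cabs (f a) * r ^+ n) ^+ 2 * ((D ^+ n) ^- 2 / 4).
  by rewrite exprD !expr_div_n; field.
have -> : (cabs (f c) / 2) ^+ 2 * (d / D) ^+ (n + n) =
    (cabs (f c) * d ^+ n) ^+ 2 * ((D ^+ n) ^- 2 / 4).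
  by rewrite exprD !expr_div_n; field.
by apply: ler_wpM2r sq; rewrite divr_ge0 ?invr_ge0 ?sqr_ge0.
Qed.

End L2_evaluation.

(** * The Bergman space *)

Section continuity_of_parts.
Variables (R : realType).
Local Notation C := (Cplx R).
Variable W : normedModType C.

Lemma continuous_Re (f : W -> C) w : differentiable f w ->
  {for w, continuous (fun w => complex.Re (f w) : R)}.
Proof.
move=> /differentiable_continuous /continuous_cabsP H.
apply: continuous_realP => e e0; have [d d0 Hd] := H e e0; exists d => // v /Hd.
by apply: le_lt_trans; rewrite -creN -creD; exact: Re_cabs.
Qed.

Lemma continuous_Im (f : W -> C) w : differentiable f w ->
  {for w, continuous (fun w => complex.Im (f w) : R)}.
Proof.
move=> /differentiable_continuous /continuous_cabsP H.
apply: continuous_realP => e e0; have [d d0 Hd] := H e e0; exists d => // v /Hd.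
by apply: le_lt_trans; rewrite -cimN -cimD; exact: Im_cabs.
Qed.

End continuity_of_parts.

Section square_integrable.
Variables (R : realType) (n : nat).
Local Notation C := (Cplx R).
Local Notation V := (Cvec R n).
Local Notation mu := (@lebesgue_Cn R n).
Variable Omega : set V.
Hypothesis oO : open Omega.
Implicit Types (f g h : V -> C) (F G : V -> C).

Let mO : measurable Omega := @open_measurable_Cvec R n Omega oO.

Lemma holo_measurable_Re f : holomorphic Omega f ->
  measurable_fun Omega (fun w => complex.Re (f w) : R).
Proof.
by move=> hf; apply: (@continuous_measurable R n Omega _ oO) => w;
  rewrite inE => Ow; apply: continuous_Re; exact: hf.
Qed.

Lemma holo_measurable_Im f : holomorphic Omega f ->
  measurable_fun Omega (fun w => complex.Im (f w) : R).
Proof.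
by move=> hf; apply: (@continuous_measurable R n Omega _ oO) => w;
  rewrite inE => Ow; apply: continuous_Im; exact: hf.
Qed.

Lemma holo_measurable_sqr f : holomorphic Omega f ->
  measurable_fun Omega (fun w => cabs (f w) ^+ 2).
Proof.
by move=> hf; apply: (@continuous_measurable R n Omega _ oO) => w;
  rewrite inE => Ow; apply: continuous_cabs_sqr; exact: hf.
Qed.

Lemma holo_measurable_Esqr f : holomorphic Omega f ->
  measurable_fun Omega (fun w => (cabs (f w) ^+ 2)%:E).
Proof. by move=> hf; apply/measurable_EFinP; exact: holo_measurable_sqr. Qed.

Definition sqnorm f : \bar R := (\int[mu]_(w in Omega) (cabs (f w) ^+ 2)%:E)%E.

Lemma sqnorm_ge0 f : (0 <= sqnorm f)%E.
Proof. by apply: integral_ge0 => w _; rewrite lee_fin sqr_ge0. Qed.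

Lemma sqnormE f : sqnorm f = (L2norm Omega f `^ 2)%E.
Proof.
rewrite /L2norm powR_Lnorm// /sqnorm [LHS]integral_mkcond.
apply: eq_integral => w _ /=; rewrite /patch; case: ifP => _; last first.
  by rewrite abse0 poweR0r.
rewrite abse_EFin poweR_EFin; congr EFin.
by rewrite -[RHS]/(`|cabs (f w)| `^ 2) ger0_norm ?cabs_ge0// powR_mulrn ?cabs_ge0.
Qed.

Lemma L2norm_ge0 f : (0 <= L2norm Omega f)%E.
Proof. exact: Lnorm_ge0. Qed.

Lemma L2norm_lty f : (L2norm Omega f < +oo)%E <-> (sqnorm f < +oo)%E.
Proof.
rewrite sqnormE; split; first exact: poweR_lty.
exact: lty_poweRy.
Qed.

Lemma L2norm_le1 f : (L2norm Omega f <= 1)%E <-> (sqnorm f <= 1)%E.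
Proof.
rewrite sqnormE; have := L2norm_ge0 f; move: (L2norm Omega f) => x x0.
case: x x0 => [r|_|//].
  rewrite lee_fin => r0; rewrite poweR_EFin !lee_fin powR_mulrn// expr_le1//.
by split; rewrite // poweRyr.
Qed.

(** The Bergman space, in the form in which the integration lemmas use it; see
bergman_spaceP. *)
Definition A2 f := holomorphic Omega f /\
  mu.-integrable Omega (fun w => (cabs (f w) ^+ 2)%:E).

(** Holomorphic functions on an open set are measurable. *)
Lemma A2P f : holomorphic Omega f -> (sqnorm f < +oo)%E -> A2 f.
Proof.
move=> hf fo; split => //; apply/integrableP; split.
  exact: holo_measurable_Esqr.
apply: le_lt_trans fo; apply: ge0_le_integral => //.
- by apply: measurableT_comp => //; exact: holo_measurable_Esqr.
- exact: holo_measurable_Esqr.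
- by move=> w _; rewrite gee0_abs// lee_fin sqr_ge0.
Qed.

Lemma A2_sqnorm f : A2 f -> (sqnorm f < +oo)%E.
Proof.
move=> [hf /integrableP[_]]; apply: le_lt_trans.
apply: ge0_le_integral => //.
- by move=> w _; rewrite lee_fin sqr_ge0.
- exact: holo_measurable_Esqr.
- by apply: measurableT_comp => //; exact: holo_measurable_Esqr.
- by move=> w _; rewrite gee0_abs// lee_fin sqr_ge0.
Qed.

Lemma bergman_spaceP f : bergman_space Omega f <-> A2 f.
Proof.
split=> [[[_ _ /L2norm_lty fo] hf]|Af]; first exact: A2P.
have [hf _] := Af; split => //; split.
- exact: holo_measurable_Re.
- exact: holo_measurable_Im.
- exact/L2norm_lty/A2_sqnorm.
Qed.

Lemma le_A2 f (u : V -> R) : holomorphic Omega f ->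
  mu.-integrable Omega (EFin \o u) ->
  (forall w, Omega w -> cabs (f w) ^+ 2 <= u w) -> A2 f.
Proof.
move=> hf iu fu; split => //; apply: le_integrable iu => //.
  exact: holo_measurable_Esqr.
by move=> w Ow; rewrite /= lee_fin ger0_norm ?sqr_ge0// (le_trans (fu w Ow))// ler_norm.
Qed.

Lemma A2D f g : A2 f -> A2 g -> A2 (fun w => f w + g w).
Proof.
move=> [hf jf] [hg jg].
apply: (@le_A2 _ (fun w => 2 * cabs (f w) ^+ 2 + 2 * cabs (g w) ^+ 2)).
- by move=> w Ow; apply: differentiableD; [exact: hf|exact: hg].
- rewrite (_ : EFin \o _ = (fun w => 2%:E * (cabs (f w) ^+ 2)%:E)%E
     \+ (fun w => 2%:E * (cabs (g w) ^+ 2)%:E)%E)%E.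
    by apply: integrableD => //; apply: integrableZl.
  by apply/funext => w /=; rewrite -!EFinM -EFinD.
move=> w Ow; have h1 := cabsD (f w) (g w); have h2 := cabs_ge0 (f w + g w).
have h3 : cabs (f w + g w) ^+ 2 <= (cabs (f w) + cabs (g w)) ^+ 2.
  by apply: lerXn2r h1; rewrite nnegrE// addr_ge0 ?cabs_ge0.
have h4 := sqr_ge0 (cabs (f w) - cabs (g w)).
by move: h3 h4; rewrite sqrrB sqrrD; arith.
Qed.

Lemma rintegrableZ (k : R) (u : V -> R) : mu.-integrable Omega (EFin \o u) ->
  mu.-integrable Omega (EFin \o (fun w => k * u w)).
Proof.
move=> iu; rewrite (_ : EFin \o _ = fun w => (k%:E * (EFin \o u) w)%E).
  exact: integrableZl.
by apply/funext => w /=; rewrite EFinM.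
Qed.

Lemma A2Z a f : A2 f -> A2 (fun w => a * f w).
Proof.
move=> [hf jf]; apply: (@le_A2 _ (fun w => cabs a ^+ 2 * cabs (f w) ^+ 2)).
- by move=> w Ow; apply: differentiableM => //; exact: hf.
- exact: rintegrableZ.
- by move=> w Ow; rewrite cabsM exprMn.
Qed.

Lemma A20 : A2 (fun=> 0).
Proof.
apply: (@le_A2 _ (fun=> 0)) => //; first exact: integrable0.
by move=> w _; rewrite cabs0 expr0n.
Qed.

Lemma A2B f g : A2 f -> A2 g -> A2 (fun w => f w - g w).
Proof.
move=> Af Ag; have := A2D Af (A2Z (-1) Ag).
by rewrite (_ : (fun w => f w + -1 * g w) = (fun w => f w - g w))//;
  apply/funext => w; rewrite mulN1r.
Qed.

Definition cintegrable F :=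
  mu.-integrable Omega (fun w => (complex.Re (F w) : R)%:E) /\
  mu.-integrable Omega (fun w => (complex.Im (F w) : R)%:E).

(** From |f g| <= |f|^2 + |g|^2. *)
Lemma A2_cintegrable f g : A2 f -> A2 g -> cintegrable (fun w => f w * (g w)^* ).
Proof.
move=> [hf jf] [hg jg].
have bd w : cabs (f w * (g w)^* ) <= cabs (f w) ^+ 2 + cabs (g w) ^+ 2.
  rewrite cabsM cabsJ; have := sqr_ge0 (cabs (f w) - cabs (g w)).
  rewrite !expr2; move: (cabs (f w)) (cabs (g w)) (cabs_ge0 (f w)) (cabs_ge0 (g w)) => x y; nra.
have js : mu.-integrable Omega (fun w => (cabs (f w) ^+ 2 + cabs (g w) ^+ 2)%:E).
  rewrite (_ : (fun w => _) = (fun w => (cabs (f w) ^+ 2)%:E) \+ (fun w => (cabs (g w) ^+ 2)%:E))%E//.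
  exact: integrableD.
have mRf := holo_measurable_Re hf; have mIf := holo_measurable_Im hf.
have mRg := holo_measurable_Re hg; have mIg := holo_measurable_Im hg.
split; apply: le_integrable js => //.
- apply/measurable_EFinP; under eq_fun do rewrite creM creJ cimJ mulrN opprK.
  by apply: measurable_funD; exact: measurable_funM.
- move=> w _; rewrite /= lee_fin [leRHS]ger0_norm ?addr_ge0 ?sqr_ge0//.
  exact: le_trans (Re_cabs _) (bd w).
- apply/measurable_EFinP; under eq_fun do rewrite cimM creJ cimJ mulrN.
  by apply: measurable_funD; [apply: measurableT_comp => //|]; exact: measurable_funM.
- move=> w _; rewrite /= lee_fin [leRHS]ger0_norm ?addr_ge0 ?sqr_ge0//.
  exact: le_trans (Im_cabs _) (bd w).
Qed.

Lemma cintegralD F G : cintegrable F -> cintegrable G ->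
  cintegral Omega (fun w => F w + G w) = cintegral Omega F + cintegral Omega G.
Proof.
move=> [rF iF] [rG iG]; apply: complex_ext; rewrite ?creD ?cimD /=.
- by under eq_Rintegral do rewrite creD; exact: RintegralD.
- by under eq_Rintegral do rewrite cimD; exact: RintegralD.
Qed.

Lemma cintegralZ a F : cintegrable F ->
  cintegral Omega (fun w => a * F w) = a * cintegral Omega F.
Proof.
move=> [rF iF]; apply: complex_ext; rewrite ?creM ?cimM /=.
- under eq_Rintegral do rewrite creM.
  rewrite RintegralB//; try exact: rintegrableZ.
  by rewrite !RintegralZl.
- under eq_Rintegral do rewrite cimM.
  rewrite RintegralD//; try exact: rintegrableZ.
  by rewrite !RintegralZl.
Qed.


Lemma inner_Dl f g h : A2 f -> A2 g -> A2 h ->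
  inner Omega (fun w => f w + g w) h = inner Omega f h + inner Omega g h.
Proof.
move=> Af Ag Ah; rewrite /inner -cintegralD; try exact: A2_cintegrable.
by congr cintegral; apply/funext => w; rewrite mulrDl.
Qed.

Lemma inner_Zl a f h : A2 f -> A2 h ->
  inner Omega (fun w => a * f w) h = a * inner Omega f h.
Proof.
move=> Af Ah; rewrite /inner -cintegralZ; last exact: A2_cintegrable.
by congr cintegral; apply/funext => w; rewrite mulrA.
Qed.

Lemma inner_Bl f g h : A2 f -> A2 g -> A2 h ->
  inner Omega (fun w => f w - g w) h = inner Omega f h - inner Omega g h.
Proof.
move=> Af Ag Ah.
have -> : (fun w => f w - g w) = (fun w => f w + -1 * g w).
  by apply/funext => w; rewrite mulN1r.
by rewrite (inner_Dl Af (A2Z (-1) Ag) Ah) (inner_Zl (-1) Ag Ah) mulN1r.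
Qed.

Lemma inner_conj f g : A2 f -> A2 g -> inner Omega g f = (inner Omega f g)^*.
Proof.
move=> Af Ag; have [rF iF] := A2_cintegrable Af Ag.
apply: complex_ext; rewrite ?creJ ?cimJ /=.
  by apply: eq_Rintegral => w _; rewrite !creM !creJ !cimJ; ring.
rewrite -[RHS]mulN1r -RintegralZl//.
by apply: eq_Rintegral => w _; rewrite !cimM !creJ !cimJ; ring.
Qed.

Lemma inner_self f : A2 f -> inner Omega f f = rc (fine (sqnorm f)).
Proof.
move=> Af; apply: complex_ext => /=.
  apply: eq_Rintegral => w _.
  by rewrite creM creJ cimJ cabs_sqr !expr2; ring.
rewrite (@eq_Rintegral _ _ _ mu Omega (fun=> 0)) ?Rintegral_cst ?mul0r// => w _.
by rewrite cimM creJ cimJ; ring.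
Qed.

Lemma fine_sqnorm f : A2 f -> sqnorm f = (fine (sqnorm f))%:E.
Proof.
by move=> Af; rewrite fineK// ge0_fin_numE ?sqnorm_ge0// A2_sqnorm.
Qed.

Lemma A2_evaluation (r : R) : 0 < r -> exists2 K : R, 0 < K &
  forall f a, A2 f -> (forall w, rnorm (w - a) <= r -> Omega w) ->
    K * cabs (f a) ^+ 2 <= fine (sqnorm f).
Proof.
move=> r0; have [K K0 HK] := @L2_point_evaluation R n (r / 2) ltac:(arith).
exists K => // f a Af aO.
have [hf _] := Af; rewrite -lee_fin -fine_sqnorm//; apply: HK => //.
by move=> w wa; apply: aO; move: wa; rewrite [2 * _]mulrC divfK.
Qed.

(** An almost everywhere null holomorphic function is null, by A2_evaluation. *)
Lemma A2_sqnorm0 f : A2 f -> fine (sqnorm f) = 0 -> forall w, Omega w -> f w = 0.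
Proof.
move=> Af f0 w Ow; have [d d0 Hd] := open_rnormP oO Ow.
have [K K0 HK] := A2_evaluation (divr_gt0 d0 (ltr0n R 2)).
have := HK f w Af; rewrite f0 => /(_ _)/wrap[].
  by move=> v vw; apply: Hd; arith.
rewrite pmulr_rle0// => h; apply/eqP; rewrite -cabs_eq0 -sqrf_eq0.
by rewrite eq_le h sqr_ge0.
Qed.

End square_integrable.

(** * Locally uniform limits *)

Section complex_limits.
Variable R : realType.
Local Notation C := (Cplx R).

(** Convergence of complex sequences in terms of real distances. *)
Definition tends (u : nat -> C) (l : C) := forall e : R, 0 < e ->
  exists N0, forall N, (N0 <= N)%N -> cabs (u N - l) <= e.

Lemma tends_cvg u l : tends u l -> u @ \oo --> l.
Proof.
move=> H; apply/cvg_cabsP => e e0; have [|N0 HN] := H (e / 2); first arith.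
by exists N0 => // N /= /HN; arith.
Qed.

Lemma tends_lim u l : tends u l -> limn u = l.
Proof. by move=> /tends_cvg ul; apply: cvg_lim => //; exact: norm_hausdorff. Qed.

Lemma tends_le u l a (c : R) N0 : tends u l ->
  (forall N, (N0 <= N)%N -> cabs (u N - a) <= c) -> cabs (l - a) <= c.
Proof.
move=> H Hc; apply/ler_addgt0Pr => e e0; have [N1 HN1] := H e e0.
have := HN1 (maxn N0 N1) (leq_maxr _ _); have := Hc (maxn N0 N1) (leq_maxl _ _).
have := cabsD (l - u (maxn N0 N1)) (u (maxn N0 N1) - a).
by rewrite addrA subrK cabsB; arith.
Qed.

Lemma real_complete (u : nat -> R) :
  (forall e : R, 0 < e -> exists N0, forall N, (N0 <= N)%N -> `|u N - u N0| <= e) ->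
  exists l, forall e : R, 0 < e ->
    exists N0, forall N, (N0 <= N)%N -> `|u N - l| <= e.
Proof.
move=> H; have /cauchy_cvg cu : cauchy (u @ \oo).
  apply: cauchy_exP => e e0; have [|N0 HN] := H (e / 2); first arith.
  exists (u N0), N0 => // N /= /HN; rewrite /ball/= distrC; arith.
exists (limn u) => e e0.
have /cvgrPdist_le/(_ e e0)[N0 _ HN] := cu.
by exists N0 => N /HN; rewrite distrC.
Qed.

Lemma complex_complete (u : nat -> C) :
  (forall e : R, 0 < e -> exists N0, forall N, (N0 <= N)%N -> cabs (u N - u N0) <= e) ->
  exists l, tends u l.
Proof.
move=> H.
have [|x Hx] := @real_complete (fun N => complex.Re (u N)).
  move=> e /H[N0 HN]; exists N0 => N /HN.
  by apply: le_trans; rewrite -creN -creD; exact: Re_cabs.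
have [|y Hy] := @real_complete (fun N => complex.Im (u N)).
  move=> e /H[N0 HN]; exists N0 => N /HN.
  by apply: le_trans; rewrite -cimN -cimD; exact: Im_cabs.
exists (Complex x y) => e e0.
have [|N1 H1] := Hx (e / 2); first arith.
have [|N2 H2] := Hy (e / 2); first arith.
exists (maxn N1 N2) => N; rewrite geq_max => /andP[/H1 h1 /H2 h2].
by apply: le_trans (cabs_ReIm _) _; rewrite creD cimD creN cimN /=; arith.
Qed.

Lemma cabs_small (x : C) (c : R) : (forall e : R, 0 < e -> cabs x <= e * c) -> x = 0.
Proof.
move=> H; apply/eqP; rewrite -cabs_eq0 eq_le cabs_ge0 andbT.
apply/ler_addgt0Pr => e e0; rewrite add0r.
have c1 : 0 < `|c| + 1 by have := normr_ge0 c; arith.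
apply: le_trans (H _ (divr_gt0 e0 c1)) _.
rewrite mulrAC ler_pdivrMr// ler_pM2l//; have := ler_norm c; arith.
Qed.

(** The differentials at a converge, pointwise on v with error e |v|, to a linear map
L; f differs from k N by a function with difference quotients at most e, so its
first-order error at a is that of k N up to a multiple of e. *)
Lemma limit_differentiable (W : normedModType C) (k : nat -> W -> C) (f : W -> C)
    (a : W) (r : R) : 0 < r ->
  (forall N, differentiable (k N) a) ->
  (forall e : R, 0 < e -> exists N0, forall N, (N0 <= N)%N ->
     (forall v, cabs ('d (k N) a v - 'd (k N0) a v) <= e * rnorm v) /\
     (forall v, rnorm v <= r ->
       cabs ((k N (a + v) - k N0 (a + v)) - (k N a - k N0 a)) <= e * rnorm v)) ->
  (forall v, rnorm v <= r -> tends (k ^~ (a + v)) (f (a + v))) ->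
  differentiable f a.
Proof.
move=> r0 dk Hk kf.
have ex (v : W) : exists l, tends (fun N => 'd (k N) a v) l.
  apply: complex_complete => e e0.
  have v1 : 0 < rnorm v + 1 by have := rnorm_ge0 v; arith.
  have [N0 HN0] := Hk _ (divr_gt0 e0 v1); exists N0 => N /HN0[H _].
  apply: le_trans (H v) _; rewrite mulrAC ler_pdivrMr// ler_pM2l//; arith.
have [L HL] := choice ex.
have HL' e : 0 < e -> exists N0, (forall v, cabs (L v - 'd (k N0) a v) <= e * rnorm v)
    /\ (forall v, rnorm v <= r ->
       cabs ((f (a + v) - f a) - (k N0 (a + v) - k N0 a)) <= e * rnorm v).
  move=> e0; have [N0 HN0] := Hk e e0; exists N0; split => v.
    by apply: (tends_le (HL v)) => N /HN0[H _]; exact: H.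
  move=> vr; apply/ler_addgt0Pr => eta eta0.
  have [N1 H1] := kf v vr (eta / 2) ltac:(arith).
  have := kf 0; rewrite rnorm0 => /(_ (ltW r0) (eta / 2) ltac:(arith)) [N2 H2].
  pose N := maxn N0 (maxn N1 N2).
  have hN0 : (N0 <= N)%N by rewrite leq_maxl.
  have hN1 : (N1 <= N)%N by rewrite /N maxnCA leq_maxl.
  have hN2 : (N2 <= N)%N by rewrite /N (maxnC N1) maxnCA leq_maxl.
  have h1 := H1 N hN1; have h2 := H2 N hN2; rewrite addr0 in h2.
  have [_ /(_ v vr) h3] := HN0 N hN0.
  have -> : f (a + v) - f a - (k N0 (a + v) - k N0 a) =
    (k N (a + v) - k N0 (a + v) - (k N a - k N0 a)) - (k N (a + v) - f (a + v))
    + (k N a - f a) by ring.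
  apply: le_trans (cabsD _ _) _; have := cabsD (k N (a + v) - k N0 (a + v) - (k N a - k N0 a))
    (- (k N (a + v) - f (a + v))); rewrite cabsN; arith.
have linL : linear L.
  move=> c u v; apply: subr0_eq.
  apply: (@cabs_small _ (rnorm (c *: u + v) + cabs c * rnorm u + rnorm v)) => e e0.
  have [N [HN _]] := HL' e e0.
  have -> : L (c *: u + v) - (c *: L u + L v) =
     (L (c *: u + v) - 'd (k N) a (c *: u + v)) - c * (L u - 'd (k N) a u)
     - (L v - 'd (k N) a v).
    rewrite ['d (k N) a (_ + _)]linearP/=; set x := L (c *: u + v).
    set du := 'd (k N) a u; set dv := 'd (k N) a v.
    rewrite -[LHS]/(x - (c * L u + L v)).
    rewrite -[RHS]/(x - (c * du + dv) - c * (L u - du) - (L v - dv)); ring.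
  apply: le_trans (cabsD _ _) _; rewrite cabsN [leRHS]mulrDr.
  apply: lerD _ (HN v); apply: le_trans (cabsD _ _) _.
  rewrite cabsN [leRHS]mulrDr; apply: lerD (HN _) _.
  by rewrite cabsM mulrCA ler_wpM2l ?cabs_ge0.
have contL : continuous L.
  move=> x; apply/continuous_cabsP => e e0.
  have [N [HN _]] := HL' 1 ltr01.
  have /continuous_cabsP/(_ (e / 2) ltac:(arith))[d d0 Hd] : {for 0, continuous ('d (k N) a)}.
    by have [cd _] := (diff_locallyP _ _).1 (dk N); exact: cd.
  exists (Num.min d (e / 2)); first by rewrite lt_min d0; arith.
  move=> w; rewrite lt_min => /andP[wd we].
  have LB : L w - L x = L (w - x).
    by have := linL (-1) x w; rewrite !scaleN1r [- x + w]addrC => ->; rewrite addrC.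
  rewrite LB; have := HN (w - x); rewrite mul1r => h1.
  have := Hd (w - x); rewrite subr0 linear0 subr0 => /(_ wd) h2.
  have := cabsD (L (w - x) - 'd (k N) a (w - x)) ('d (k N) a (w - x)); rewrite subrK; arith.
apply: (smallo_differentiable linL contL) => e e0.
have [N [HN1 HN2]] := HL' (e / 3) ltac:(arith).
have [d d0 Hd] := differentiable_smallo (dk N) (e := e / 3) ltac:(arith).
exists (Num.min d r); first by rewrite lt_min d0.
move=> v; rewrite lt_min => /andP[vd vr].
have h1 := HN1 v; have h2 := HN2 v (ltW vr); have h3 := Hd v vd.
have -> : f (a + v) - f a - L v = (f (a + v) - f a - (k N (a + v) - k N a))
  + (k N (a + v) - k N a - 'd (k N) a v) - (L v - 'd (k N) a v) by ring.
apply: le_trans (cabsD _ _) _; rewrite cabsN.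
have := cabsD (f (a + v) - f a - (k N (a + v) - k N a)) (k N (a + v) - k N a - 'd (k N) a v).
arith.
Qed.

Lemma diffB_apply (W : normedModType C) (f g : W -> C) x v :
  differentiable f x -> differentiable g x ->
  'd (fun w => f w - g w) x v = 'd f x v - 'd g x v.
Proof.
move=> df dg; have H := diffB df dg.
exact: (congr1 (fun F : W -> C => F v) H).
Qed.

(** Cauchy estimates turn uniform smallness of k N - k M on a ball into smallness of
the gradient and of the difference quotients at the centre. *)
Lemma weierstrass_convergence (W : normedModType C) (k : nat -> W -> C)
    (f : W -> C) (a : W) (r : R) : 0 < r ->
  (forall N w, rnorm (w - a) <= r -> differentiable (k N) w) ->
  (forall e : R, 0 < e -> exists N0, forall N w, (N0 <= N)%N ->
     rnorm (w - a) <= r -> cabs (k N w - k N0 w) <= e) ->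
  (forall w, rnorm (w - a) <= r -> tends (k ^~ w) (f w)) ->
  differentiable f a.
Proof.
move=> r0 dk uk kf.
have aa : rnorm (a - a) <= r by rewrite subrr rnorm0 ltW.
apply: (@limit_differentiable W k f a (r / 2)); first arith.
- by move=> N; exact: dk.
- move=> e e0.
  have er : 0 < e * r / 16 by rewrite divr_gt0// mulr_gt0.
  have [N0 HN0] := uk _ er; exists N0 => N N0N.
  have hb : holo_bounded (fun w => k N w - k N0 w) a r (e * r / 16).
    by move=> w wa; split; [apply: differentiableB; exact: dk|exact: HN0].
  split=> v.
    rewrite -(diffB_apply v (dk N a aa) (dk N0 a aa)).
    apply: le_trans (cauchy_gradient v r0 hb) _; rewrite ler_pdivrMr//.
    have := mulr_ge0 (mulr_ge0 (ltW e0) (ltW r0)) (rnorm_ge0 v); arith.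
  move=> vr; have := cauchy_lipschitz r0 hb vr.
  by rewrite (_ : 16 * (e * r / 16) * rnorm v / r = e * rnorm v)//; field; rewrite gt_eqF.
- by move=> v vr; apply: kf; rewrite addrC addKr; arith.
Qed.

End complex_limits.

(** * The Bergman kernel *)

Section kernel_series.
Variables (R : realType) (n : nat).
Local Notation C := (Cplx R).
Local Notation V := (Cvec R n).
Local Notation mu := (@lebesgue_Cn R n).
Variables (Omega : set V) (h : nat -> V -> C).
Hypothesis oO : open Omega.
Hypothesis Ah : forall j, A2 Omega (h j).
Hypothesis ortho : forall i j, inner Omega (h i) (h j) = (i == j)%:R.
Implicit Types (c : nat -> C) (s : seq nat).

Definition combination c s (w : V) : C := \sum_(j <- s) c j * h j w.

Lemma combination_cons c i s :
  combination c (i :: s) = fun w => c i * h i w + combination c s w.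
Proof. by apply/funext => w; rewrite /combination big_cons. Qed.

Lemma A2_combination c s : A2 Omega (combination c s).
Proof.
elim: s => [|i s IH].
  rewrite (_ : combination c [::] = fun=> 0); first exact: A20.
  by apply/funext => w; rewrite /combination big_nil.
rewrite combination_cons.
exact: (A2D oO (A2Z oO (c i) (Ah i)) IH).
Qed.

Lemma inner_combinationl c s g : A2 Omega g ->
  inner Omega (combination c s) g = \sum_(j <- s) c j * inner Omega (h j) g.
Proof.
move=> Ag; elim: s => [|i s IH].
  rewrite big_nil (_ : combination c [::] = fun w => 0 * g w).
    by rewrite inner_Zl// mul0r.
  by apply/funext => w; rewrite /combination big_nil mul0r.
rewrite big_cons -IH combination_cons.
rewrite (inner_Dl oO (A2Z oO (c i) (Ah i)) (A2_combination c s) Ag).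
by rewrite (inner_Zl oO (c i) (Ah i) Ag).
Qed.

(** Pythagoras. *)
Lemma sqnorm_combination c s : uniq s ->
  fine (sqnorm Omega (combination c s)) = \sum_(j <- s) cabs (c j) ^+ 2.
Proof.
move=> us; have Ak := A2_combination c s.
apply: rc_inj; rewrite -inner_self// inner_combinationl//.
rewrite (big_morph _ (@rcD R) (@rc0 R)) big_seq [RHS]big_seq; apply: eq_bigr => i si.
rewrite (inner_conj oO Ak (Ah i)) inner_combinationl//.
rewrite (bigD1_seq i)//= ortho eqxx mulr1 big1 ?addr0.
  apply: complex_ext; rewrite ?creM ?cimM creJ cimJ /= ?cabs_sqr ?expr2; ring.
by move=> j ji; rewrite ortho (negbTE ji) mulr0.
Qed.

Variable z : V.
Hypothesis Oz : Omega z.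

Let a j : C := (h j z)^*.
Let S N : R := \sum_(0 <= j < N) cabs (a j) ^+ 2.

(** Bessel's inequality for evaluation at z: the value at z of the N-th
partial sum is S N, and so is its squared norm, whence K (S N)^2 <= S N by
A2_evaluation. *)
Lemma kernel_coefficients_bounded : exists B, forall N, S N <= B.
Proof.
have [d d0 Hd] := open_rnormP oO Oz.
have [K K0 HK] := A2_evaluation oO (divr_gt0 d0 (ltr0n R 2)).
exists K^-1 => N.
have := HK (combination a (index_iota 0 N)) z (A2_combination _ _).
rewrite sqnorm_combination ?iota_uniq// => /(_ _)/wrap[].
  by move=> w wz; apply: Hd; arith.
have -> : combination a (index_iota 0 N) z = rc (S N).
  rewrite /combination /S (big_morph _ (@rcD R) (@rc0 R)); apply: eq_bigr => j _.
  by apply: complex_ext; rewrite ?creM ?cimM /a creJ cimJ cabsJ /= ?cabs_sqr ?expr2; ring.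
have S0 : 0 <= S N by apply: sumr_ge0 => j _; rewrite sqr_ge0.
rewrite cabs_rc ger0_norm// -/(S N) => H.
have [->|SN0] := eqVneq (S N) 0; first by rewrite invr_ge0 ltW.
have SN : 0 < S N by rewrite lt_def SN0.
rewrite -(ler_pM2l K0) divff ?gt_eqF// -(ler_pM2r SN) mul1r -mulrA -expr2.
exact: H.
Qed.

Lemma kernel_tail (e : R) : 0 < e -> exists N0, forall M N, (N0 <= M)%N -> (M <= N)%N ->
  \sum_(M <= j < N) cabs (a j) ^+ 2 <= e.
Proof.
move=> e0; have [B HB] := kernel_coefficients_bounded.
have hs : has_sup (range S) by split; [exists (S 0%N), 0%N|exists B => _ [N _ <-]].
have [_ [N0 _ <-] hN0] := sup_adherent e0 hs.
exists N0 => M N N0M MN.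
have split_sum p q : (p <= q)%N -> S q = S p + \sum_(p <= j < q) cabs (a j) ^+ 2.
  by move=> pq; rewrite /S -big_cat_nat.
have : S N <= sup (range S) by apply: sup_upper_bound => //; exists N.
have SM : S N0 <= S M.
  by rewrite (split_sum _ _ N0M) lerDl sumr_ge0// => j _; rewrite sqr_ge0.
move: hN0; rewrite (split_sum _ _ MN); arith.
Qed.

Let k N : V -> C := combination a (index_iota 0 N).

Lemma partial_kernel_tail M N : (M <= N)%N ->
  (fun w => k N w - k M w) = combination a (index_iota M N).
Proof.
move=> MN; apply/funext => w.
by rewrite /k /combination (@big_cat_nat _ _ _ M 0%N N)//= addrAC subrr add0r.
Qed.

(** The squared norm of k N - k M is a piece of a convergent series, and it controls
the values at points around which Omega contains a ball of radius r. *)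
Lemma kernel_uniformly_cauchy (r e : R) : 0 < r -> 0 < e -> exists N0,
  forall M N w, (N0 <= M)%N -> (M <= N)%N ->
  (forall v, rnorm (v - w) <= r -> Omega v) -> cabs (k N w - k M w) <= e.
Proof.
move=> r0 e0; have [K K0 HK] := A2_evaluation oO r0.
have [N0 HN0] := @kernel_tail (K * e ^+ 2) (mulr_gt0 K0 (exprn_gt0 2 e0)).
exists N0 => M N w N0M MN Ow.
have := HK _ w (A2_combination a (index_iota M N)) Ow.
rewrite -partial_kernel_tail// => H.
have : K * cabs (k N w - k M w) ^+ 2 <= K * e ^+ 2.
  apply: le_trans H _; rewrite partial_kernel_tail// sqnorm_combination ?iota_uniq//.
  exact: HN0.
by rewrite ler_pM2l// ler_pXn2r// nnegrE ?cabs_ge0// ltW.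
Qed.

Lemma kernel_partial_tends w : Omega w -> tends (k ^~ w) (bergman_kernel h w z).
Proof.
move=> Ow; have [d d0 Hd] := open_rnormP oO Ow.
have [l Hl] : exists l, tends (k ^~ w) l.
  apply: complex_complete => e e0.
  have [N0 HN0] := kernel_uniformly_cauchy (divr_gt0 d0 (ltr0n R 2)) e0.
  exists N0 => N N0N; apply: HN0 => // v vw; apply: Hd; arith.
rewrite /bergman_kernel (_ : series _ = k ^~ w) ?(tends_lim Hl)//.
by apply/funext => N; apply: eq_bigr => j _; rewrite mulrC.
Qed.

Lemma holomorphic_combination c s : holomorphic Omega (combination c s).
Proof. by have [] := A2_combination c s. Qed.

Lemma kernel_holomorphic : holomorphic Omega (bergman_kernel h ^~ z).
Proof.
move=> x Ox; have [d d0 Hd] := open_rnormP oO Ox.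
pose r := d / 4; have r0 : 0 < r by rewrite /r; arith.
have inO w : rnorm (w - x) <= r -> forall v, rnorm (v - w) <= r -> Omega v.
  move=> wx v vw; apply: Hd; rewrite -(subrK w v) -addrA.
  by apply: le_lt_trans (rnormD _ _) _; move: wx vw; rewrite /r; arith.
apply: (@weierstrass_convergence R V k _ x r r0).
- move=> N w wx; apply: holomorphic_combination.
  by apply: (inO w wx); rewrite subrr rnorm0 ltW.
- move=> e e0; have [N0 HN0] := kernel_uniformly_cauchy r0 e0.
  by exists N0 => N w N0N wx; exact: (HN0 N0 N w (leqnn _) N0N (inO w wx)).
- move=> w wx; apply: kernel_partial_tends.
  by apply: (inO w wx); rewrite subrr rnorm0 ltW.
Qed.

(** Square integrability is Fatou's lemma: the squared norms of the partial sums are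
the bounded S N. *)
Lemma kernel_A2 : A2 Omega (bergman_kernel h ^~ z).
Proof.
apply: A2P => //; first exact: kernel_holomorphic.
have [B HB] := kernel_coefficients_bounded.
pose g N w : \bar R := (cabs (k N w) ^+ 2)%:E.
have glim w : Omega w -> g ^~ w @ \oo --> (cabs (bergman_kernel h w z) ^+ 2)%:E.
  move=> Ow; apply: cvg_EFin; first by near=> N.
  rewrite [X in X @ _ --> _](_ : _ = (fun x : R => x ^+ 2) \o (fun N => cabs (k N w))); last first.
    by apply/funext.
  apply: continuous_cvg; first exact: exprn_continuous.
  apply/cvgrPdist_le => e e0; have [N0 HN0] := kernel_partial_tends Ow e0.
  exists N0 => // N /= /HN0; apply: le_trans.
  by rewrite distrC cabs_dist.
have mg N : measurable_fun Omega (g N).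
  by apply: holo_measurable_Esqr => //; exact: holomorphic_combination.
have := @fatou _ _ _ mu Omega (@open_measurable_Cvec R n Omega oO) g mg.
move=> /(_ (fun N w _ => ltac:(by rewrite lee_fin sqr_ge0))) H.
apply: (@le_lt_trans _ _ B%:E); last exact: ltry.
apply: le_trans (le_trans H _).
  rewrite le_eqVlt; apply/orP; left; apply/eqP; apply: eq_integral => w.
  rewrite inE => Ow.
  rewrite is_cvg_limn_einfE; last by apply: cvgP; exact: glim.
  by apply/esym/cvg_lim => //; exact: glim.
rewrite limn_einf_lim; apply: lime_le; first exact: is_cvg_einfs.
near=> N; apply: (@le_trans _ _ (sqnorm Omega (k N))).
  by apply: ereal_inf_lbound; exists N => /=.
rewrite fine_sqnorm//; last exact: A2_combination.
by rewrite lee_fin sqnorm_combination ?iota_uniq//; exact: HB.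
Unshelve. all: by end_near. Qed.

End kernel_series.

(** * First-order data at a point *)

Section directional_derivative.
Variable R : realType.
Local Notation C := (Cplx R).
Variable W : normedModType C.
Implicit Types (f g : W -> C) (x v : W).

Lemma derive_sub f g x v : differentiable f x -> differentiable g x ->
  'D_v (fun w => f w - g w) x = 'D_v f x - 'D_v g x.
Proof.
move=> df dg.
exact: (deriveB (@diff_derivable _ _ _ _ _ v df) (@diff_derivable _ _ _ _ _ v dg)).
Qed.

Lemma derive_mul f g x v : differentiable f x -> differentiable g x ->
  'D_v (fun w => f w * g w) x = f x * 'D_v g x + g x * 'D_v f x.
Proof.
move=> df dg.
exact: (deriveM (@diff_derivable _ _ _ _ _ v df) (@diff_derivable _ _ _ _ _ v dg)).
Qed.

Lemma derive_scale (a : C) f x v : differentiable f x ->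
  'D_v (fun w => a * f w) x = a * 'D_v f x.
Proof. by move=> df; exact: (@deriveZ _ _ _ f a _ _ (@diff_derivable _ _ _ _ _ v df)). Qed.

End directional_derivative.

Section tangent_rules.
Variables (R : realType) (n : nat).
Local Notation C := (Cplx R).
Local Notation V := (Cvec R n).
Implicit Types (f g : V -> C) (z X : V).

Lemma tangent_sub X f g z : differentiable f z -> differentiable g z ->
  tangent X (fun w => f w - g w) z = tangent X f z - tangent X g z.
Proof.
move=> df dg; rewrite /tangent -sumrB; apply: eq_bigr => j _.
by rewrite (derive_sub _ df dg) mulrBr.
Qed.

Lemma tangent_scale X (a : C) f z : differentiable f z ->
  tangent X (fun w => a * f w) z = a * tangent X f z.
Proof.
move=> df; rewrite /tangent mulr_sumr; apply: eq_bigr => j _.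
by rewrite (derive_scale _ _ df) mulrCA.
Qed.

Lemma tangent_mul X f g z : differentiable f z -> differentiable g z ->
  tangent X (fun w => f w * g w) z = f z * tangent X g z + g z * tangent X f z.
Proof.
move=> df dg; rewrite /tangent !mulr_sumr -big_split; apply: eq_bigr => j _ /=.
by rewrite (derive_mul _ df dg) mulrDr; congr (_ + _); rewrite mulrCA.
Qed.

End tangent_rules.

(** * The extremal function and the projection *)

Section extremal_function.
Variables (R : realType) (n : nat).
Local Notation C := (Cplx R).
Local Notation V := (Cvec R n).
Variable Omega : set V.
Hypothesis oO : open Omega.
Implicit Types (f g b s : V -> C).

(** By default maximum is 0, so a positive value is attained and maximal. *)
Lemma maximum_upper_bound (A : set C) (m : C) : 0 < m -> m = maximum A ->
  forall x, A x -> x <= m.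
Proof.
move=> m0 mE x Ax; move: m0; rewrite mE /maximum.
set P := [set m | _]; case: (pselect (P !=set0)) => [[y Py]|nP].
  have [_] := @xgetPex _ 0 P (ex_intro _ y Py).
  by move=> /(_ x Ax).
by rewrite xgetPN ?ltxx// => y Py; apply: nP; exists y.
Qed.

(** Both mixed terms of the expansion equal t |<f, s>|^2. *)
Lemma sqnorm_gradient_step f s (t : R) : A2 Omega f -> A2 Omega s ->
  fine (sqnorm Omega (fun w => f w - rc t * inner Omega f s * s w)) =
  fine (sqnorm Omega f) - 2 * t * cabs (inner Omega f s) ^+ 2
  + t ^+ 2 * cabs (inner Omega f s) ^+ 2 * fine (sqnorm Omega s).
Proof.
move=> Af As; set i := inner Omega f s; set al := rc t * i.
have Aas : A2 Omega (fun w => al * s w) by exact: A2Z.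
set f' := fun w => _; have Af' : A2 Omega f' by exact: A2B.
apply: rc_inj; rewrite -inner_self//.
rewrite {1}/f' inner_Bl// inner_Zl//.
rewrite (inner_conj oO Af' Af) (inner_conj oO Af' As) /f' !inner_Bl// !inner_Zl//.
rewrite (inner_conj oO Af As) -/i !inner_self//.
apply: complex_ext; rewrite ?(creD, cimD, creN, cimN, creM, cimM, creJ, cimJ) /= ?cabs_sqr /al ?(creM, cimM) /=; ring.
Qed.

Lemma sqnorm_scale f (a : C) : A2 Omega f ->
  fine (sqnorm Omega (fun w => a * f w)) = cabs a ^+ 2 * fine (sqnorm Omega f).
Proof.
move=> Af; have Aaf := @A2Z R n Omega oO a f Af; apply: rc_inj.
rewrite -(inner_self oO Aaf) (inner_Zl oO a Af Aaf) (inner_conj oO Aaf Af).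
rewrite (inner_Zl oO a Af Af) (inner_self oO Af).
by apply: complex_ext; rewrite ?(creM, cimM, creJ, cimJ) /= ?cabs_sqr; ring.
Qed.

(** For a function of squared norm N that is smaller than 1 by at least t m, the
factor tau brings the squared norm back to at most 1 and exceeds 1 unless m = 0. *)
Lemma rescaling_factor (N m t : R) : 0 <= N -> N <= 1 - t * m -> 0 < t -> 0 <= m ->
  let tau := Num.sqrt (2 / (1 + N)) in tau ^+ 2 * N <= 1 /\ (tau <= 1 -> m = 0).
Proof.
move=> N0 N1 t0 m0 tau.
have tau2 : tau ^+ 2 = 2 / (1 + N) by rewrite sqr_sqrtr// divr_ge0//; arith.
have tm : 0 <= t * m by rewrite mulr_ge0// ltW.
split; first by rewrite tau2 mulrAC ler_pdivrMr; arith.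
move=> tau1; have : tau ^+ 2 <= 1 by rewrite expr_le1// sqrtr_ge0.
rewrite tau2 ler_pdivrMr; last arith.
move=> N1'; apply/eqP; rewrite eq_le m0 andbT -(pmulr_rle0 _ t0); arith.
Qed.

(** Take the step b' = b - t <b, s> s with t = 1 / (1 + |s|^2): the first-order data
at z are unchanged while the squared norm drops by at least t |<b, s>|^2.
Rescaling b' by the factor tau of rescaling_factor gives a competitor, so that
tau <= 1 and <b, s> = 0. *)
Lemma extremal_orthogonal z X b s : Omega z ->
  bergman_competitors Omega z b -> `|tangent X b z| = bergman_max Omega z X ->
  0 < tangent X b z -> vanishing_space Omega z X s -> inner Omega b s = 0.
Proof.
move=> Oz [hb bz /L2norm_le1 nb] bmax b0 [/(bergman_spaceP oO) As sz Xs].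
have Ab : A2 Omega b by apply: A2P => //; exact: le_lt_trans nb (ltry _).
set i := inner Omega b s.
pose ns := fine (sqnorm Omega s).
have ns0 : 0 <= ns by apply: fine_ge0; exact: sqnorm_ge0.
pose t := (1 + ns)^-1.
have t0 : 0 < t by rewrite invr_gt0; arith.
have tns : t * ns <= 1 by rewrite /t mulrC ler_pdivrMr; arith.
pose b' (w : V) : C := b w - rc t * i * s w.
have Aas : A2 Omega (fun w => rc t * i * s w) by exact: A2Z.
have Ab' : A2 Omega b' by exact: A2B.
pose N := fine (sqnorm Omega b').
have N0 : 0 <= N by apply: fine_ge0; exact: sqnorm_ge0.
have nb1 : fine (sqnorm Omega b) <= 1 by rewrite -lee_fin -fine_sqnorm.
have N1 : N <= 1 - t * cabs i ^+ 2.
  rewrite /N /b' (sqnorm_gradient_step t Ab As) -/i -/ns.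
  have := sqr_ge0 (cabs i); have := ler_wpM2l (ltW t0) tns.
  move: (cabs i ^+ 2) => m h m0; have := ler_wpM2l m0 h; arith.
have [hs _] := As.
have db := hb z Oz; have ds := hs z Oz.
have das : differentiable (fun w => rc t * i * s w) z by have [H _] := Aas; exact: H.
have Xb' : tangent X b' z = tangent X b z.
  by rewrite (tangent_sub X db das) (tangent_scale X (rc t * i) ds) Xs mulr0 subr0.
have [tauN tau1] := rescaling_factor N0 N1 t0 (sqr_ge0 _).
set tau := Num.sqrt _ in tauN tau1.
have Atb : A2 Omega (fun w => rc tau * b' w) by exact: A2Z.
have comp : bergman_competitors Omega z (fun w => rc tau * b' w).
  split; first by have [] := Atb.
    by rewrite /b' bz sz mulr0 subr0 mulr0.
  apply/L2norm_le1; rewrite (fine_sqnorm oO Atb) lee_fin.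
  by rewrite (sqnorm_scale _ Ab') cabs_rc real_normK ?num_real.
have babs : `|tangent X b z| = tangent X b z := ger0_norm (ltW b0).
have db' : differentiable b' z by have [H _] := Ab'; exact: H.
rewrite babs in bmax.
have := maximum_upper_bound b0 bmax (ex_intro2 _ _ _ comp erefl).
rewrite (tangent_scale X (rc tau) db') Xb' normrM babs (ger_pMl _ b0).
rewrite cabsE cabs_rc -rc1 rc_le (ger0_norm (sqrtr_ge0 _)) => /tau1 /eqP.
by rewrite sqrf_eq0 cabs_eq0 => /eqP.
Qed.

(** The difference of two projections of f lies in W and is orthogonal to W, hence to
itself. *)
Lemma orthogonal_projection_unique (S : set (V -> C)) f g :
  S `<=` bergman_space Omega -> A2 Omega f -> orthogonal_complement Omega S g ->
  (forall w, orthogonal_complement Omega S w -> inner Omega (f \- g) w = 0) ->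
  forall zeta, Omega zeta ->
  g zeta = orthogonal_projection Omega (orthogonal_complement Omega S) f zeta.
Proof.
move=> SA Af Wg fg zeta Oz; rewrite /orthogonal_projection.
set P := [set g | _]; have [Wp fp] := @xgetPex _ (fun=> 0) P (ex_intro _ g (conj Wg fg)).
set p := xget _ P in Wp fp *.
have [/(bergman_spaceP oO) Ag gS] := Wg; have [/(bergman_spaceP oO) Ap pS] := Wp.
pose D (w : V) : C := g w - p w.
have AD : A2 Omega D by exact: A2B.
have WD : orthogonal_complement Omega S D.
  split; first exact/bergman_spaceP.
  move=> s Ss; have /(bergman_spaceP oO) As := SA s Ss.
  by rewrite /D inner_Bl// gS// pS// subrr.
have : inner Omega D D = 0.
  have -> : inner Omega D D = inner Omega (f \- p) D - inner Omega (f \- g) D.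
    rewrite -(inner_Bl oO (A2B oO Af Ap) (A2B oO Af Ag) AD).
    congr (inner _ _ D); apply/funext => w.
    by rewrite opprB [RHS]addrC addrA subrK.
  by rewrite fg// fp// subrr.
rewrite inner_self// => -[D0].
by have /eqP := A2_sqnorm0 oO AD D0 Oz; rewrite subr_eq0 => /eqP.
Qed.

End extremal_function.

(** * The projection formula *)

Theorem mainTheorem2 (R : realType) (n : nat)
    (Omega : set (Cvec R n)) (z X : Cvec R n)
    (h : nat -> Cvec R n -> Cplx R) (c b : Cvec R n -> Cplx R)
    (Omega_open : open Omega) (Omega_connected : connected Omega)
    (Omega_bounded : bounded_set Omega)
    (Omega_z : Omega z) (X_neq0 : X != 0)
    (h_basis : complete_orthonormal_basis Omega h)
    (c_holo : holomorphic Omega c) (c_z : c z = 0)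
    (c_lt1 : forall zeta, Omega zeta -> `|c zeta| < 1)
    (c_max : tangent X c z = caratheodory_metric Omega z X)
    (b_comp : bergman_competitors Omega z b)
    (b_max : `|tangent X b z| = bergman_max Omega z X)
    (b_gt0 : 0 < tangent X b z) :
  forall zeta, Omega zeta ->
    caratheodory_metric Omega z X / bergman_metric Omega h z X * b zeta =
    orthogonal_projection Omega
      (orthogonal_complement Omega (vanishing_space Omega z X))
      (fun xi => normalized_kernel h z xi * c xi) zeta.
Proof.
have [hA ho _] := h_basis.
have Ah j : A2 Omega (h j) by apply/(bergman_spaceP Omega_open); exact: hA.
have AK := kernel_A2 Omega_open Ah ho Omega_z.
set K := bergman_kernel h z z; set s := sqrtC K.
(* Also when K = 0, the inverse of 0 being 0. *)
have Kss : K / s = s.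
  have [s0|s0] := eqVneq s 0; first by rewrite s0 invr0 mulr0.
  by apply: (mulIf s0); rewrite (divfK s0) -expr2 /s sqrtCK.
have Akz : A2 Omega (normalized_kernel h z).
  rewrite (_ : normalized_kernel h z = fun w => s^-1 * bergman_kernel h w z).
    exact: A2Z.
  by apply/funext => w; rewrite /normalized_kernel mulrC.
have [kz_holo kz_int] := Akz.
pose F xi := normalized_kernel h z xi * c xi.
have AF : A2 Omega F.
  apply: (le_A2 Omega_open (u := fun w => cabs (normalized_kernel h z w) ^+ 2)) kz_int _.
    by move=> w Ow; apply: differentiableM; [exact: kz_holo|exact: c_holo].
  move=> w Ow; rewrite cabsM exprMn.
  have c1 : cabs (c w) <= 1.
    by have := c_lt1 w Ow; rewrite cabsE -rc1 rc_lt => /ltW.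
  rewrite -[leRHS]mulr1; apply: ler_wpM2l; first exact: sqr_ge0.
  by rewrite expr_le1 ?cabs_ge0.
have [b_holo b_z /L2norm_le1 b_norm] := b_comp.
have Ab : A2 Omega b.
  apply: (A2P Omega_open b_holo); exact: le_lt_trans b_norm (ltry _).
have db := b_holo z Omega_z; have dc := c_holo z Omega_z.
have dk := kz_holo z Omega_z.
pose la := caratheodory_metric Omega z X / bergman_metric Omega h z X.
have Alb : A2 Omega (fun w => la * b w) by exact: A2Z.
have laE : la * tangent X b z = s * tangent X c z.
  rewrite /la -c_max /bergman_metric -b_max (ger0_norm (ltW b_gt0)) -/K -/s.
  have Xb0 : tangent X b z != 0 by rewrite gt_eqF.
  by rewrite invfM invrK -mulrA -mulrA (mulVf Xb0) mulr1 mulrC.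
have AFb : A2 Omega (fun w => F w - la * b w) by exact: A2B.
have FbS : vanishing_space Omega z X (fun w => F w - la * b w).
  split; first exact/(bergman_spaceP Omega_open).
    by rewrite /F c_z b_z !mulr0 subr0.
  have [FH _] := AF; have [lbH _] := Alb.
  rewrite (tangent_sub X (FH z Omega_z) (lbH z Omega_z)) (tangent_scale X la db) laE.
  by rewrite (tangent_mul X dk dc) c_z mul0r addr0 /normalized_kernel -/K -/s Kss subrr.
have lbW : orthogonal_complement Omega (vanishing_space Omega z X) (fun w => la * b w).
  split; first exact/(bergman_spaceP Omega_open).
  move=> t tS; have [/(bergman_spaceP Omega_open) At _ _] := tS.
  rewrite (inner_Zl Omega_open la Ab At).
  by rewrite (extremal_orthogonal Omega_open Omega_z b_comp b_max b_gt0 tS) mulr0.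
apply: (orthogonal_projection_unique Omega_open _ AF lbW).
  by move=> t [].
move=> w [/(bergman_spaceP Omega_open) Aw wS].
by rewrite (inner_conj Omega_open Aw AFb) wS// conjC0.
Qed.
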